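(* Let $B_1,\dots,B_s$ be real $M\times M$ matrices and let $\Sigma_1,\dots,\Sigma_s$ be real $N\times N$ positive definite matrices. Suppose $\mathbf W_1\in\mathcal W(\Sigma_1,B_1),\dots,\mathbf W_s\in\mathcal W(\Sigma_s,B_s)$ are independent. Then for every $n\ge1$, every $t:\{1,\dots,n\}\to\{1,\dots,s\}$ and every $\sigma\in\mathcal F_n^+$, $$\mathbb E\big(p_{\sigma,t}(\mathbf W_1,\dots,\mathbf W_s)\big)=\sum_{\gamma\in\mathcal F_n(t)}q_{\gamma,t}(B_1,\dots,B_s)\,p_{\sigma\circledcirc\gamma,\,t(\sigma,\gamma)}(\Sigma_1,\dots,\Sigma_s).$$
   Context: Wishart matrices. For a real symmetric positive definite $N\times N$ matrix $\Sigma$ and a real $M\times M$ matrix $B$, $\mathbf W\in\mathcal W(\Sigma,B)$ means $\mathbf W=A'\mathbf X'B\mathbf XA$, where $\mathbf X$ is an $M\times N$ matrix of i.i.d. $N(0,1)$ random variables, $A$ is symmetric with $A'A=A^2=\Sigma$, and $'$ is transpose. Pair partitions. $\mathcal F_n$ is the set of partitions of $\{\pm1,\dots,\pm n\}$ into two-element sets. $\gamma\in\mathcal F_n$ is identified with a fixed-point-free involution ($\gamma(i)=j$ iff $\{i,j\}\in\gamma$) and with a graph on $\{\pm1,\dots,\pm n\}$ whose edges are its pairs. $\delta\in\mathcal F_n$ is $\delta(j)=-j$. $\mathcal F_n^+$ is the set of $\sigma\in\mathcal F_n$ all of whose pairs consist of one positive and one negative integer. The permutation $\pi(\gamma)\in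 S_n$ and signs $\varepsilon(\gamma)=(\varepsilon_1(\gamma),\dots,\varepsilon_n(\gamma))\in\{+,-\}^n$ are read from the 2-regular graph $\delta\cup\gamma$: let $j$ be the smallest element of $\{1,\dots,n\}$ not yet used, put $v_1=j$ and $v_{k+1}=-\gamma(v_k)$ (cross an edge of $\gamma$, then an edge of $\delta$) until the first return $v_{r+1}=v_1$. Then $(|v_1|,\dots,|v_r|)$ is a cycle of $\pi(\gamma)$ and $\varepsilon_{|v_k|}(\gamma)$ is the sign of $v_k$. Repeat until all elements of $\{1,\dots,n\}$ are used. (For $\sigma\in\mathcal F_n^+$, $\pi(\sigma)(j)=-\sigma(j)$ and all signs are $+$.) $\mathcal C(\gamma)$ is the set of cycles of $\pi(\gamma)$, including fixed points. Brauer product. For $\sigma\in\mathcal F_n^+$, $\gamma\in\mathcal F_n$, the element $\sigma\circledcirc\gamma\in\mathcal F_n$ is $$(\sigma\circledcirc\gamma)(j)=\begin{cases}\sigma(-\gamma(j)), & j>0,\ \gamma(j)<0,\\ \gamma(j), & j>0,\ \gamma(j)>0,\\ \sigma(-\gamma(-\sigma(j))), & j<0,\ \gamma(-\sigma(j))<0,\\ \gamma(-\sigma(j)), & j<0,\ \gamma(-\sigma(j))>0.\end{cases}$$ Colorings. For $t:\{1,\dots,n\}\to\{1,\dots,s\}$, $\mathcal F_n(t)=\{\gamma\in\mathcal F_n: t(|\gamma(j)|)=t(|j|)\text{ for all }j=\pm1,\dots,\pm n\}$. For $\gamma\in\mathcal F_n(t)$ each edge $\{u,v\}$ of $\gamma$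 has color $t(|u|)=t(|v|)$. Each edge of $\sigma\circledcirc\gamma$ comes from exactly one edge $\{u,v\}$ of $\gamma$ (it is $\{\varphi(u),\varphi(v)\}$ with $\varphi(w)=w$ for $w>0$ and $\varphi(w)=\sigma(-w)$ for $w<0$) and inherits its color. The coloring $t(\sigma,\gamma):\{1,\dots,n\}\to\{1,\dots,s\}$ assigns to $i$ the color of the edge of $\sigma\circledcirc\gamma$ crossed when passing from $i$ to the next element of its cycle of $\pi(\sigma\circledcirc\gamma)$ in the traversal of $\delta\cup(\sigma\circledcirc\gamma)$ given by $v_1=j$ (with $j$ the smallest element of $\{1,\dots,n\}$ not yet used), $v_{k+1}=-(\sigma\circledcirc\gamma)(v_k)$ (cross an edge of $\sigma\circledcirc\gamma$, then an edge of $\delta$), i.e. the edge containing $\varepsilon_i(\sigma\circledcirc\gamma)\,i$. Explicitly, $t(\sigma,\gamma)(i)=t(i)$ if $\varepsilon_i(\sigma\circledcirc\gamma)=+$ and $t(\sigma,\gamma)(i)=t(\sigma(-i))$ if $\varepsilon_i(\sigma\circledcirc\gamma)=-$. Monomials. For $\gamma\in\mathcal F_n$, $t:\{1,\dots,n\}\to\{1,\dots,s\}$ and square matrices $\mathbf x_1,\dots,\mathbf x_s$, $$p_{\gamma,t}(\mathbf x_1,\dots,\mathbf x_s)=\prod_{c\in\mathcal C(\gamma)}\mathrm{tr}\Big(\prod_{j\in c}\mathbf x_{t(j)}\Big),\qquad q_{\gamma,t}(\mathbf x_1,\dots,\mathbf x_s)=\prod_{c\in\mathcal C(\gamma)}\mathrm{tr}\Big(\prod_{j\in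 c}\mathbf x_{t(j)}^{-\varepsilon_j(\gamma)}\Big),$$ where $\mathbf x^{+}=\mathbf x$, $\mathbf x^{-}=\mathbf x'$ (so $-\varepsilon_j=-$, i.e. a transpose, when $\varepsilon_j=+$), products over a cycle are taken in the order in which the integers appear in the cycle, and $\mathrm{tr}$ is unnormalized. *)

(* Defs.v *)
From HB Require Import structures.
From mathcomp Require Import all_boot all_order all_algebra.
From mathcomp Require Import all_classical all_reals all_analysis.

Set Implicit Arguments.
Unset Strict Implicit.
Unset Printing Implicit Defensive.

Import Order.TTheory GRing.Theory Num.Theory.

Local Open Scope classical_set_scope.
Local Open Scope ring_scope.

Section PairPartitions.
Variable n : nat.

(* The index set {+1, ..., +n, -1, ..., -n}: (true, i) is +(i+1) and (false, i)
   is -(i+1), so j.1 tells whether j > 0 and j.2 is |j|. *)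
Definition pmidx : Type := (bool * 'I_n)%type.

Definition pmpos (i : 'I_n) : pmidx := (true, i).
Definition pmopp (j : pmidx) : pmidx := (~~ j.1, j.2).

(* A partition into two-element sets is represented by the fixed-point-free
   involution exchanging the two elements of each block. *)
Definition pairings : {set {ffun pmidx -> pmidx}} :=
  [set g : {ffun pmidx -> pmidx} | [forall j, (g (g j) == j) && (g j != j)]]%SET.

Definition pairings_plus : {set {ffun pmidx -> pmidx}} :=
  [set g in pairings | [forall j, (g j).1 != j.1]]%SET.

(* [cycle_from g j] is v_1, ..., v_r with v_1 = +j and v_(k+1) = - g (v_k), up
   to the first return; [traversal g] collects these sequences, each started
   at the smallest j whose absolute value does not occur in the earlier ones
   ([enum 'I_n] is increasing). *)
Definition cycle_from (g : pmidx -> pmidx) (j : 'I_n) : seq pmidx :=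
  fingraph.orbit (fun v => pmopp (g v)) (pmpos j).

Definition traversal (g : pmidx -> pmidx) : seq (seq pmidx) :=
  foldl (fun cs j => if j \in [seq v.2 | v <- flatten cs] then cs
                     else rcons cs (cycle_from g j))
        [::] (enum 'I_n).

(* The cycles (fixed points included) of the permutation pi(g). *)
Definition cycles (g : pmidx -> pmidx) : seq (seq 'I_n) :=
  [seq [seq v.2 | v <- c] | c <- traversal g].

(* The sign epsilon_i(g), [true] standing for +. *)
Definition eps (g : pmidx -> pmidx) (i : 'I_n) : bool :=
  pmpos i \in flatten (traversal g).

Definition brauer (s g : pmidx -> pmidx) : {ffun pmidx -> pmidx} :=
  [ffun j : pmidx =>
     if j.1 then (if (g j).1 then g j else s (pmopp (g j)))
     else let k := g (pmopp (s j)) in if k.1 then k else s (pmopp k)].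

Variable C : finType.

Definition colored_pairings (t : 'I_n -> C) : {set {ffun pmidx -> pmidx}} :=
  [set g in pairings | [forall j, t (g j).2 == t j.2]]%SET.

(* t(s, g) : the color inherited by the edge of [brauer s g] that contains
   epsilon_i i, where epsilon_i = epsilon_i(brauer s g). *)
Definition brauer_coloring (s g : pmidx -> pmidx) (t : 'I_n -> C) (i : 'I_n) : C :=
  if eps (brauer s g) i then t i else t (s (pmopp (pmpos i))).2.

Variables (R : comPzRingType) (m : nat).

Definition monomial_p (g : pmidx -> pmidx) (t : 'I_n -> C) (x : C -> 'M[R]_m) : R :=
  \prod_(c <- cycles g) \tr (\big[mulmx/1%:M]_(j <- c) x (t j)).

Definition monomial_q (g : pmidx -> pmidx) (t : 'I_n -> C) (x : C -> 'M[R]_m) : R :=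
  \prod_(c <- cycles g)
    \tr (\big[mulmx/1%:M]_(j <- c) (if eps g j then (x (t j))^T else x (t j))).

End PairPartitions.

Definition posdefmx (R : numDomainType) (N : nat) (S : 'M[R]_N) : Prop :=
  S^T = S /\ forall v : 'cV[R]_N, v != 0 -> 0 < (v^T *m S *m v) 0 0.

Section RandomMatrices.
Context {d : measure_display} {T : measurableType d} {R : realType}.
Variable P : probability T R.

Definition mutually_independent (I : finType) (F : I -> set_system T) : Prop :=
  forall (J : {set I}) (E : I -> set T),
    (forall i, i \in J -> F i (E i)) ->
    P (\bigcap_(i in [set` J]) E i) = (\prod_(i in J) P (E i))%E.

(* The sigma-algebra generated by the entries of a random matrix. *)
Definition sigma_mx (m n : nat) (W : T -> 'M[R]_(m, n)) : set_system T :=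
  <<s \bigcup_(ij in [set: 'I_m * 'I_n])
        g_sigma_algebra_preimage (fun w : T => (W w ij.1 ij.2 : R)) >>.

(* The laws are compared on measurable sets only: the values of a measure
   outside the sigma-algebra are unspecified. *)
Definition iid_standard_normal (M N : nat) (X : 'I_M -> 'I_N -> {RV P >-> R}) : Prop :=
  (forall i j (A : set R), measurable A ->
     distribution P (X i j) A = normal_prob 0 1 A) /\
  mutually_independent
    (fun ij : 'I_M * 'I_N => g_sigma_algebra_preimage (X ij.1 ij.2)).

Definition rmx (M N : nat) (X : 'I_M -> 'I_N -> {RV P >-> R}) (w : T) : 'M[R]_(M, N) :=
  \matrix_(i, j) X i j w.

(* [A] is any symmetric square root of [Sigma], not necessarily positive. *)
Definition wishart (M N : nat) (Sigma : 'M[R]_N) (B : 'M[R]_M)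
    (W : T -> 'M[R]_N) : Prop :=
  exists (A : 'M[R]_N) (X : 'I_M -> 'I_N -> {RV P >-> R}),
    [/\ A^T = A, A^T *m A = Sigma, iid_standard_normal X &
        forall w, W w = A^T *m (rmx X w)^T *m B *m rmx X w *m A].

End RandomMatrices.

(* Main.v *)
Require Import Defs.
From HB Require Import structures.
From mathcomp Require Import all_boot all_order all_algebra.
From mathcomp Require Import all_classical all_reals all_analysis.
From mathcomp Require Import perm measurable_realfun ring lra.

Set Implicit Arguments.
Unset Strict Implicit.
Unset Printing Implicit Defensive.

Import Order.TTheory GRing.Theory Num.Theory.
Import numFieldNormedType.Exports.

Local Open Scope classical_set_scope.
Local Open Scope ring_scope.

(** Write W_l = A' X_l' B_l X_l A with A = A_l a symmetric square root of
    Sigma_l, and expand p_(sigma,t)(W) completely into entries.  A product of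
    traces over the cycles of a permutation pi is the sum, over all index
    functions a, of the products of the entries x_i(a_i, a_(pi i))
    [prod_tr_cycles]; expanding each entry of W as well attaches to every
    signed index k = +i, -i one Gaussian variable X_l(b_k, c_k), l being the
    color of i.  The result is a sum over a, b, c of products of entries of A
    and B times a Gaussian moment that depends only on the labelling
    k |-> (t |k|, b_k, c_k).

    The W_l are independent, so this moment is a product with one expectation
    for each color, and inside each X_l the entries are independent
    [Rintegral_prod_indep].  Hence it is a product over the labels v of the
    moments of order #{k labelled v} of one standard normal variable, which
    satisfy m_0 = 1, m_1 = 0 and m_(k+2) = (k+1) m_k [normal_momentE].  The same
    recursion counts the pairings of the signed indices that only pair equal
    labels [card_pairings_on]: this is Wick's formula.

    It remains to exchange the sums and evaluate, for a fixed pairing gamma that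
    respects t, the sums over b and c that are constant on the pairs of gamma.
    The sum over b closes up along the cycles of delta and gamma and gives
    q_(gamma,t)(B) [monomial_qE].  In the sum over c each pair of gamma merges
    two entries of A into one entry of A'A = Sigma, located at the two indices
    a that sigma attaches to the ends of the pair.  Relabelling the ends in this
    way turns gamma into its Brauer product with sigma, so that the sum over a
    closes up along the cycles of that product and gives the second factor
    [monomial_p_brauer].

    Both closing arguments rest on one property of the traversal of a pairing g:
    it visits exactly one of +i, -i for each i [traversalP], and therefore
    exactly one end of each pair of g, because v |-> - g(v) permutes the visited
    elements. *)

(** * Counting pairings compatible with a labelling *)

(** The moment of order [k] of the standard normal law: (k-1)!! for even [k],
    and 0 for odd [k]. *)
Fixpoint gauss_moment (k : nat) : nat :=
  match k with
  | 0 => 1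
  | 1 => 0
  | k'.+2 => (k'.+1 * gauss_moment k')%N
  end.

Section PairingCount.
Local Open Scope nat_scope.
Variables (K V : finType) (kap : K -> V).

(** Pairings of a subset [D] are extended by the identity outside [D], so that
    those of all subsets live in one type and can be compared in an induction
    on [#|D|]. *)
Definition pairings_on (D : {set K}) : {set {ffun K -> K}} :=
  [set g : {ffun K -> K} | [forall j, if j \in D then
     [&& g j \in D, g (g j) == j, g j != j & kap (g j) == kap j]
   else g j == j]]%SET.

Definition twist (x y : K) (g : {ffun K -> K}) : {ffun K -> K} :=
  [ffun j => g (tperm x y j)].

Lemma twistK x y : involutive (twist x y).
Proof. by move=> g; apply/ffunP => j; rewrite !ffunE tpermK. Qed.

(** If [g] pairs [x] with [y], composing it with the transposition of [x] and
    [y] turns both into fixed points and changes nothing else: this deletes the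
    pair {x, y}, and doing it again restores it. *)
Lemma twist_pairings_on (D : {set K}) x y g : x \in D -> y \in D -> x != y ->
  kap y = kap x ->
  ((twist x y g \in pairings_on D) && (twist x y g x == y)) =
  (g \in pairings_on (D :\ x :\ y)).
Proof.
move=> xD yD xy kxy; apply/andP/idP.
  case; rewrite !inE ffunE tpermL => /forallP h /eqP gy.
  have gx : g x = x.
    by have := h x; rewrite xD !ffunE tpermL gy tpermR => /and4P[_ /eqP].
  apply/forallP => j; rewrite !inE.
  have [->|jy] := eqVneq j y; first by rewrite /= gy eqxx.
  have [->|jx] := eqVneq j x; first by rewrite andbF gx eqxx.
  have := h j; rewrite !ffunE /=.
  have tj : tperm x y j = j by rewrite tpermD // eq_sym.
  case: ifP => jD; last by rewrite tj.
  rewrite !tj => /and4P[gjD /eqP ggj gjj kj].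
  have gjy : g j != y.
    by apply/eqP => e; move: ggj; rewrite e tpermR gx => e2; rewrite e2 eqxx in jx.
  have gjx : g j != x.
    by apply/eqP => e; move: ggj; rewrite e tpermL gy => e2; rewrite e2 eqxx in jy.
  rewrite gjy gjx gjD gjj kj /= andbT.
  by move: ggj; rewrite tpermD 1?eq_sym // => ->.
rewrite inE => /forallP h.
have gx : g x = x by have := h x; rewrite !inE eqxx andbF => /eqP.
have gy : g y = y by have := h y; rewrite !inE eqxx => /eqP.
rewrite ffunE tpermL gy eqxx; split=> //.
rewrite inE; apply/forallP => j; rewrite !ffunE.
have [->|jy] := eqVneq j y.
  by rewrite yD tpermR gx xD tpermL gy eqxx xy kxy eqxx.
have [->|jx] := eqVneq j x.
  by rewrite xD tpermL gy yD tpermR gx eqxx eq_sym xy kxy eqxx.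
have := h j; rewrite !inE jy jx /= tpermD 1?eq_sym //.
case: ifP => // jD /and4P[/and3P[gjy gjx gjD] ggj gjj kj].
have tg : tperm x y (g j) = g j by rewrite tpermD // eq_sym.
by rewrite tg gjD gjj kj ggj.
Qed.

Lemma card_pairings_on_fiber (D : {set K}) x y : x \in D -> y \in D -> x != y ->
  kap y = kap x ->
  #|[set g in pairings_on D | g x == y]%SET| = #|pairings_on (D :\ x :\ y)|.
Proof.
move=> xD yD xy kxy.
rewrite -(card_imset _ (inv_inj (twistK x y))).
apply: eq_card => g; rewrite -(twist_pairings_on g xD yD xy kxy).
apply/imsetP/idP.
  by case=> h; rewrite inE => hh ->; rewrite twistK.
by move=> h; exists (twist x y g); rewrite ?twistK // inE.
Qed.

(** If c elements of [D] carry the label of [x], then [x] can be paired with any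
    of the c - 1 others, and each choice leaves c - 2 elements with that label:
    this is the recursion of [gauss_moment]. *)
Lemma card_pairings_on (D : {set K}) :
  #|pairings_on D| =
  \prod_(v : V) gauss_moment #|[set k in D | kap k == v]%SET|.
Proof.
have [m] := ubnP #|D|; elim: m D => // m IH D; rewrite ltnS => Dm.
have [->|/finset.set0Pn [x xD]] := eqVneq D finset.set0.
  rewrite big1 => [|v _]; last first.
    apply/(congr1 gauss_moment (y := 0)); apply: eq_card0 => k.
    by rewrite !inE.
  apply/eqP/finset.cards1P; exists [ffun k => k]; apply/finset.setP => g; rewrite !inE.
  apply/forallP/eqP => [h|-> j]; last by rewrite inE ffunE.
  by apply/ffunP => j; rewrite ffunE; have := h j; rewrite inE => /eqP.
pose E := [set k in D | kap k == kap x]%SET :\ x.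
have step : #|pairings_on D| = \sum_(y in E) #|pairings_on (D :\ x :\ y)|.
  rewrite -sum1_card (partition_big (fun g : {ffun K -> K} => g x) (mem E)) /=.
    apply: eq_bigr => y; rewrite !inE => /and3P[yx yD /eqP kyx].
    rewrite -(card_pairings_on_fiber xD yD) 1?eq_sym //.
    by rewrite -sum1_card; apply: eq_bigl => g; rewrite !inE.
  move=> g; rewrite inE => /forallP/(_ x); rewrite xD => /and4P[gD _ gx kg].
  by rewrite !inE gx gD kg.
pose F v := [set k in D | kap k == v]%SET.
have cF y v : y \in E ->
  #|[set k in D :\ x :\ y | kap k == v]%SET| = if v == kap x then #|F v|.-2 else #|F v|.
  rewrite !inE => /and3P[yx yD /eqP kyx].
  case: ifP => [/eqP->|/eqP nv].
    rewrite (cardsD1 x (F _)) (cardsD1 y (F _ :\ x)) !inE xD yD yx kyx eqxx /=.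
    by apply: eq_card => k; rewrite !inE -!andbA.
  apply: eq_card => k; rewrite !inE; have [->|_] := eqVneq k y.
    by rewrite kyx /= yD /=; apply/esym/negbTE/eqP=> e; case: nv.
  have [->|//] := eqVneq k x; rewrite xD /=.
  by apply/esym/negbTE/eqP=> e; case: nv.
rewrite step (eq_bigr (fun=> gauss_moment #|F (kap x)|.-2 *
   \prod_(v | v != kap x) gauss_moment #|F v|)); last first.
  move=> y yE; rewrite IH; last first.
    move: yE; rewrite !inE => /and3P[yx yD _]; apply: leq_trans Dm.
    by rewrite (cardsD1 x D) xD (cardsD1 y (D :\ x)) !inE yx yD /= !add1n.
  rewrite (bigD1 (kap x)) //= cF // eqxx; congr (_ * _).
  by apply: eq_bigr => v nv; rewrite cF // (negbTE nv).
rewrite sum_nat_const [RHS](bigD1 (kap x)) //= mulnA; congr (_ * _).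
rewrite -/(F _) (_ : #|F (kap x)| = #|E|.+1); last first.
  by rewrite (cardsD1 x) !inE xD eqxx.
by case: #|E| => //= e; rewrite mul0n.
Qed.

End PairingCount.

(** The case of the signed indices: the number of pairings that only pair equal
    labels. *)
Lemma card_invariant_pairings (n : nat) (V : finType) (kap : pmidx n -> V) :
  #|[set g in pairings n | [forall k, kap (g k) == kap k]]%SET| =
  (\prod_v gauss_moment #|[set k | kap k == v]%SET|)%N.
Proof.
transitivity #|pairings_on kap [set: pmidx n]%SET|.
  apply: eq_card => g; rewrite !inE.
  apply/andP/forallP => [[/forallP h1 /forallP h2] k|h].
    by rewrite !inE /= h2 andbT.
  split; apply/forallP => k; have := h k; rewrite !inE => /and4P[_ h1 h2 h3] //.
  by rewrite h1 h2.
rewrite card_pairings_on; apply: eq_bigr => v _; congr gauss_moment.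
by apply: eq_card => k; rewrite !inE.
Qed.

(** * The traversal of a pairing *)

Section Traversal.
Variables (n : nat) (g : {ffun pmidx n -> pmidx n}).
Hypothesis g_pairing : g \in pairings n.

Local Notation next := (fun v => pmopp (g v)).
Local Notation abs := (fun v : pmidx n => v.2).

Lemma pairing_invol : involutive g.
Proof. by move=> j; move: g_pairing; rewrite inE => /forallP/(_ j)/andP[/eqP]. Qed.

Lemma pairing_neq j : g j != j.
Proof. by move: g_pairing; rewrite inE => /forallP/(_ j)/andP[]. Qed.

Lemma pmoppK : involutive (@pmopp n).
Proof. by move=> [b i]; rewrite /pmopp /= negbK. Qed.

Lemma pmopp_neq (v : pmidx n) : pmopp v != v.
Proof. by case: v => b i; rewrite /pmopp xpair_eqE /=; case: b. Qed.

Lemma eq_abs (u v : pmidx n) : u.2 = v.2 -> u = v \/ u = pmopp v.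
Proof.
case: u v => [a i] [b j] /= ->; rewrite /pmopp /=.
by case: a; case: b; auto.
Qed.

Lemma next_inj : injective next.
Proof. exact: inj_comp (inv_inj pmoppK) (inv_inj pairing_invol). Qed.

Lemma next_pmopp v : next (pmopp (next v)) = pmopp v.
Proof. by rewrite /= pmoppK pairing_invol. Qed.

(** Negation conjugates the step v |-> - g(v) to its inverse, hence it maps
    orbits to orbits. *)
Lemma fconnect_pmopp u v : fconnect next u v -> fconnect next (pmopp u) (pmopp v).
Proof.
move=> /iter_findex <-; elim: (findex _ _ _) => [|k IH] //=.
apply: connect_trans IH _; rewrite fconnect_sym; last exact: next_inj.
by apply/connect1/eqP; rewrite -[RHS]next_pmopp.
Qed.

(** Going from [v] to [- v] in [k + 2] steps would mean going from the successor
    of [v] to its opposite in [k] steps; ending at [k = 0] or [k = 1] this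
    contradicts that negation, respectively [g], has no fixed point. *)
Lemma fconnect_pmoppF v : ~~ fconnect next v (pmopp v).
Proof.
apply/negP => /iter_findex; move: (findex _ _ _) => k.
have [m] := ubnP k; elim: m k v => // m IH [|[|k]] v; rewrite ltnS => km.
- by move=> /esym/eqP; rewrite (negbTE (pmopp_neq v)).
- by move=> /= /(inv_inj pmoppK)/eqP; rewrite (negbTE (pairing_neq v)).
move=> e; apply: (IH k (next v)); first by rewrite ltnW.
apply: next_inj; rewrite [RHS]next_pmopp -e.
by rewrite [RHS]iterS [iter k.+1 _ _]iterSr.
Qed.

Definition traversal_step (cs : seq (seq (pmidx n))) j :=
  if j \in [seq v.2 | v <- flatten cs] then cs else rcons cs (cycle_from g j).

(** Each cycle stays recorded as a full orbit, so that the visited set is closed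
    under the step and under its inverse; the second field says that +i and -i
    are never both visited. *)
Record traversal_inv (cs : seq (seq (pmidx n))) : Prop := TraversalInv {
  trav_orbit : forall c, c \in cs -> exists j, c = cycle_from g j;
  trav_uniq : uniq (map abs (flatten cs)) }.

Lemma trav_next cs v : traversal_inv cs ->
  forall u, v \in flatten cs -> fconnect next v u -> u \in flatten cs.
Proof.
move=> [orb _] u /flattenP[c cc vc] vu; apply/flattenP; exists c => //.
have [j ec] := orb _ cc; move: vc; rewrite {}ec -!fconnect_orbit => jv.
exact: connect_trans jv vu.
Qed.

(** If the new orbit met an older one up to sign, then, both being orbits,
    [+j] or [-j] would already belong to the older one. *)
Lemma traversal_stepP cs j : traversal_inv cs -> traversal_inv (traversal_step cs j).
Proof.
rewrite /traversal_step; case: ifPn => // jn H; split.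
  move=> c; rewrite mem_rcons inE => /predU1P[->|/(trav_orbit H)//].
  by exists j.
rewrite flatten_rcons map_cat cat_uniq (trav_uniq H) /=; apply/andP; split.
  apply/hasPn => _ /mapP[u uc ->]; apply/negP => /mapP[w wc /= uw].
  move: uc; rewrite -fconnect_orbit => ju; case/negP: jn.
  have uj : fconnect next u (pmpos j) by rewrite fconnect_sym //; exact: next_inj.
  case: (eq_abs uw) uj => -> uj.
    by apply/mapP; exists (pmpos j) => //; apply: trav_next uj.
  apply/mapP; exists (pmopp (pmpos j)) => //; apply: (trav_next H wc).
  by have := fconnect_pmopp uj; rewrite pmoppK.
rewrite map_inj_in_uniq ?fingraph.orbit_uniq // => u v.
rewrite -!fconnect_orbit => ju jv /eq_abs[//|e].
have : fconnect next v u.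
  by apply: connect_trans ju; rewrite fconnect_sym //; exact: next_inj.
by rewrite e (negbTE (fconnect_pmoppF v)).
Qed.

Lemma traversalP : traversal_inv (traversal g) /\
  forall i, i \in map abs (flatten (traversal g)).
Proof.
rewrite /traversal -/traversal_step.
suff H (r : seq 'I_n) cs : traversal_inv cs ->
    let cs' := foldl traversal_step cs r in
    [/\ traversal_inv cs', {subset map abs (flatten cs) <= map abs (flatten cs')} &
     forall i, i \in r -> i \in map abs (flatten cs')].
  have [|h1 _ h2] := H (enum 'I_n) [::]; first by split.
  by split=> // i; apply: h2; rewrite mem_enum.
elim: r cs => [|j r IH] cs Hcs /=; first by split.
have Hj := traversal_stepP j Hcs; have [h1 h2 h3] := IH _ Hj; split=> //.
  move=> i ics; apply: h2; rewrite /traversal_step; case: ifP => // _.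
  by rewrite flatten_rcons map_cat mem_cat ics.
move=> i; rewrite inE => /predU1P[->|]; last exact: h3.
apply: h2; rewrite /traversal_step; case: ifP => // _.
rewrite flatten_rcons map_cat mem_cat; apply/orP; right.
by apply/mapP; exists (pmpos j) => //; rewrite -fconnect_orbit connect0.
Qed.

(** The sign that the traversal attaches to [i] is the one of the only element
    of {+i, -i} that it goes through; see [visitedP]. *)
Definition visited (i : 'I_n) : pmidx n := (eps g i, i).

Lemma visitedP v : (v \in flatten (traversal g)) = (v == visited v.2).
Proof.
have [H cov] := traversalP; have /mapP[u uT eu] := cov v.2.
case: v uT eu => b i /= uT eu; rewrite /visited /= xpair_eqE eqxx andbT /eps.
have uniqT w : w \in flatten (traversal g) -> w.2 = u.2 -> w = u.
  move=> wT e; have := trav_uniq H; move: wT uT e.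
  elim: (flatten _) => //= x l IH; rewrite !inE.
  move=> /predU1P[->|wl] /predU1P[->|ul] // e /andP[xn ul'].
  - by case/negP: xn; apply/mapP; exists u.
  - by case/negP: xn; apply/mapP; exists w.
  - exact: IH.
have inT b' : ((b', i) \in flatten (traversal g)) = (b' == u.1).
  apply/idP/eqP => [bT|->]; last by rewrite eu -surjective_pairing.
  by rewrite -(uniqT _ bT eu).
by rewrite !inT; case: b; case: (u.1).
Qed.

Lemma visited_traversal i : visited i \in flatten (traversal g).
Proof. by rewrite visitedP. Qed.

Lemma next_visited i : next (visited i) = visited (g (visited i)).2.
Proof.
apply/eqP; rewrite -visitedP; have [H _] := traversalP.
by apply: (trav_next H) (visited_traversal i) _; apply: fconnect1.
Qed.

(** The end of a pair opposite to the next visited element is not visited: exactly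
    one end of each pair is. *)
Lemma pairing_visited i : g (visited i) = pmopp (visited (g (visited i)).2).
Proof. by rewrite -next_visited pmoppK. Qed.

(** This is the permutation pi(g), as a function. *)
Definition cycle_succ (i : 'I_n) : 'I_n := (g (visited i)).2.

Lemma flatten_cycles : perm_eq (flatten (cycles g)) (enum 'I_n).
Proof.
have [H cov] := traversalP; rewrite -map_flatten.
apply: uniq_perm; rewrite ?enum_uniq ?(trav_uniq H) // => i.
by rewrite cov mem_enum.
Qed.

Lemma fcycle_cycles c : c \in cycles g -> c != [::] /\ fcycle cycle_succ c.
Proof.
have [H cov] := traversalP; case/mapP => c' cc -> {c}.
have [j ec] := trav_orbit H cc.
split; first by rewrite ec /cycle_from -size_eq0 size_map size_orbit -lt0n order_gt0.
have fc : fcycle next c' by rewrite ec; exact: cycle_orbit next_inj _.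
have sub v : v \in c' -> v = visited v.2.
  by move=> vc; apply/eqP; rewrite -visitedP; apply/flattenP; exists c'.
rewrite cycle_map; apply: (sub_in_cycle (P := mem c')) fc; last exact/allP.
by move=> u v uc vc /= /eqP <-; rewrite /cycle_succ -(sub _ uc) eqxx.
Qed.

End Traversal.

(** * Products of traces as sums over index functions *)

Section IteratedSum.
Variables (R : comPzRingType) (I J : finType).
Implicit Types (a b : {ffun I -> J}) (r : seq I) (F G : {ffun I -> J} -> R).

Definition ffupd a (i : I) (x : J) : {ffun I -> J} :=
  [ffun k => if k == i then x else a k].

(** Summing one coordinate at a time over a sequence of indices makes it possible
    to follow a cycle step by step; the coordinates outside of the sequence are
    held fixed by [a], which avoids partial functions. *)
Fixpoint iter_sum r F a : R :=
  if r is i :: r' then \sum_(x : J) iter_sum r' F (ffupd a i x) else F a.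

Lemma iter_sumE r F a : uniq r ->
  iter_sum r F a = \sum_(b : {ffun I -> J} | [forall i, (i \in r) || (b i == a i)]) F b.
Proof.
elim: r a => [|i r IH] a /=.
  move=> _; rewrite (big_pred1 a) // => b; apply/forallP/eqP => /= [h|-> //].
  by apply/ffunP => i; have := h i => /eqP.
move=> /andP[ir ur].
rewrite [RHS](partition_big (fun b : {ffun I -> J} => b i) xpredT) //=.
apply: eq_bigr => x _; rewrite IH //; apply: eq_bigl => b.
apply/forallP/andP => [h|[/forallP h /eqP bi] k].
  split; last by have := h i; rewrite (negbTE ir) ffunE eqxx.
  apply/forallP => k; rewrite inE; have [//|ki] := eqVneq k i.
  by have := h k; rewrite ffunE (negbTE ki).
have := h k; rewrite inE ffunE; have [->|//] := eqVneq k i.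
by rewrite bi eqxx orbT.
Qed.

Lemma eq_iter_sum r F G a : uniq r ->
  (forall b, (forall i, i \notin r -> b i = a i) -> F b = G b) ->
  iter_sum r F a = iter_sum r G a.
Proof.
move=> ur FG; rewrite !iter_sumE //; apply: eq_bigr => b /forallP h; apply: FG => i ir.
by have := h i; rewrite (negbTE ir) => /eqP.
Qed.

Lemma sum_ffun_iter_sum F a : \sum_b F b = iter_sum (enum I) F a.
Proof.
rewrite iter_sumE ?enum_uniq //; apply: eq_bigl => b.
by apply/esym/forallP => i; rewrite mem_enum.
Qed.

Lemma iter_sum_cat r r' F a : iter_sum (r ++ r') F a = iter_sum r (iter_sum r' F) a.
Proof. by elim: r a => //= i r IH a; apply: eq_bigr => x _; apply: IH. Qed.

Lemma iter_sum_mull r F G a : uniq r ->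
  (forall b, (forall i, i \notin r -> b i = a i) -> F b = F a) ->
  iter_sum r (fun b => F b * G b) a = F a * iter_sum r G a.
Proof.
move=> ur Fa; rewrite !iter_sumE // big_distrr /=; apply: eq_bigr => b /forallP h.
by rewrite Fa // => i ir; have := h i; rewrite (negbTE ir) => /eqP.
Qed.

End IteratedSum.

Section TraceCycles.
Variables (R : comPzRingType) (N : nat) (I : finType) (f : I -> I).
Variable y : I -> 'M[R]_N.
Implicit Types (a b : {ffun I -> 'I_N}) (c : seq I).

Let prodmx c := \big[mulmx/1%:M]_(j <- c) y j.
Let weight c a := \prod_(j <- c) y j (a j) (a (f j)).

(** The inner summations of a product of matrices.  The last factor of the path
    has its column index prescribed to be [z]: on a cycle, [z] is the value at the
    first index, which closes the path into a trace. *)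
Lemma iter_sum_path j p a z : fpath f j p -> uniq (j :: p) ->
  iter_sum p (fun b => \prod_(k <- j :: p)
            y k (b k) (if k == last j p then z else b (f k))) a =
  prodmx (j :: p) (a j) z.
Proof.
elim: p j a => [|k p IH] j a.
  by move=> _ _; rewrite /prodmx /= !big_cons !big_nil eqxx mulr1 mulmx1.
rewrite [fpath _ _ _]/= [uniq _]/= => /andP[/eqP fj fp] /andP[jkp kp].
rewrite /prodmx big_cons mxE [LHS]/=; apply: eq_bigr => x _.
have jk : j != k by apply: contraNneq jkp => ->; rewrite mem_head.
have jl : (j == last k p) = false.
  by apply: contraNF jkp => /eqP->; exact: mem_last.
transitivity (iter_sum p (fun b => y j (b j) (b k) * \prod_(k0 <- k :: p)
            y k0 (b k0) (if k0 == last k p then z else b (f k0))) (ffupd a k x)).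
  by congr (iter_sum _ _ _); apply/funext => b; rewrite big_cons /= jl fj.
move: jkp; rewrite inE negb_or => /andP[_ jp].
have /andP[kp' up] := kp.
rewrite iter_sum_mull //; last by move=> b hb; rewrite !hb.
by rewrite IH // !ffunE eqxx (negbTE jk).
Qed.

Lemma iter_sum_cycle c a : c != [::] -> fcycle f c -> uniq c ->
  iter_sum c (weight c) a = \tr (prodmx c).
Proof.
case: c => [//|j p] _ cp up; rewrite /mxtrace [LHS]/=; apply: eq_bigr => x _.
have /= /andP[jp up'] := up.
move: cp; rewrite [fcycle _ _]/= rcons_path => /andP[fp /eqP fl].
rewrite -[X in prodmx _ X _](_ : ffupd a j x j = x); last by rewrite ffunE eqxx.
rewrite -iter_sum_path //; apply: eq_iter_sum => // b hb.
apply: eq_bigr => k _; case: ifP => // /eqP ->; rewrite fl.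
by rewrite (hb j) // ffunE eqxx.
Qed.

(** Disjoint cycles involve disjoint sets of coordinates, so the sums factor. *)
Lemma iter_sum_cycles (cs : seq (seq I)) a : uniq (flatten cs) ->
  (forall c, c \in cs -> c != [::] /\ fcycle f c) ->
  iter_sum (flatten cs) (fun b => \prod_(c <- cs) weight c b) a =
  \prod_(c <- cs) \tr (prodmx c).
Proof.
elim: cs a => [|c cs IH] a /=; first by move=> _ _; rewrite !big_nil.
rewrite cat_uniq => /and3P[uc /hasPn dis ucs] H.
have [cn fc] := H c (mem_head _ _).
have IH' b : iter_sum (flatten cs) (fun b => \prod_(c <- cs) weight c b) b =
  \prod_(c <- cs) \tr (prodmx c).
  by apply: IH => // c' c'cs; apply: H; rewrite inE c'cs orbT.
rewrite big_cons -(iter_sum_cycle a cn fc uc) iter_sum_cat [RHS]mulrC.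
rewrite -[RHS](iter_sum_mull (F := fun=> \prod_(c <- cs) \tr (prodmx c))) //.
congr (iter_sum _ _ _); apply/funext => b; rewrite -(IH' b) mulrC.
rewrite -iter_sum_mull //.
  by congr (iter_sum _ _ _); apply/funext => b'; rewrite big_cons.
move=> b' hb'; rewrite /weight !big_seq; apply: eq_bigr => k kc.
have notin i : i \in c -> i \notin flatten cs.
  by move=> ic; apply/negP => /dis; rewrite ic.
rewrite !hb' ?notin //.
by rewrite (eqP (next_cycle fc kc)) mem_next.
Qed.

(** The iterated sums need some function to start from; without any, the matrices
    have size 0 while [I] has an element, and both sides vanish. *)
Lemma prod_tr_cycles (cs : seq (seq I)) :
  perm_eq (flatten cs) (enum I) ->
  (forall c, c \in cs -> c != [::] /\ fcycle f c) ->
  \prod_(c <- cs) \tr (\big[mulmx/1%:M]_(j <- c) y j) =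
  \sum_(a : {ffun I -> 'I_N}) \prod_i y i (a i) (a (f i)).
Proof.
move=> csI H; have ucs : uniq (flatten cs) by rewrite (perm_uniq csI) enum_uniq.
have [a _|noa] := pickP (xpredT : pred {ffun I -> 'I_N}); last first.
  rewrite [RHS]big1; last by move=> a; have := noa a.
  case: cs csI H {ucs} => [|c cs] csI H.
    have cI : #|I| = 0%N by rewrite cardE -(perm_size csI).
    by have := noa (ffun0 cI).
  have [cn _] := H c (mem_head _ _); rewrite big_cons.
  have N0 : N = 0%N.
    by case: (N) noa => // m noa; have := noa [ffun=> ord0].
  rewrite /mxtrace [X in X * _]big1 ?mul0r // => i.
  by have := ltn_ord i; rewrite {2}N0.
rewrite -(iter_sum_cycles a ucs H) (sum_ffun_iter_sum _ a) !iter_sumE ?enum_uniq //.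
apply: eq_big => b.
  by apply: eq_forallb => i; rewrite (perm_mem csI).
move=> _; transitivity (\prod_(i <- enum I) y i (b i) (b (f i))); last first.
  by rewrite big_enum.
by rewrite -(perm_big _ csI) big_flatten.
Qed.

End TraceCycles.

(** * Sums over functions that are constant on the pairs *)

Lemma prod_signed (R : comPzRingType) (n : nat) (H : pmidx n -> R) :
  \prod_k H k = \prod_i (H (true, i) * H (false, i)).
Proof.
rewrite (eq_bigr (fun k => H (k.1, k.2))) => [|[] //].
rewrite -(pair_bigA _ (fun b i => H (b, i))) /= exchange_big /=.
by apply: eq_bigr => i _; rewrite big_bool.
Qed.

Section PairingSums.
Variables (n : nat) (g : {ffun pmidx n -> pmidx n}).
Hypothesis g_pairing : g \in pairings n.

Local Notation succ := (cycle_succ g).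

Lemma cycle_succ_inj : injective succ.
Proof.
move=> i j ij; have := pairing_visited g_pairing i.
rewrite -/(succ i) ij -(pairing_visited g_pairing j).
by move=> /(inv_inj (pairing_invol g_pairing))/(congr1 snd).
Qed.

Lemma cycle_succ_surj j : exists i, succ i = j.
Proof. by exists (invF cycle_succ_inj j); rewrite f_invF. Qed.

Lemma not_visited k : (k != visited g k.2) = (k == pmopp (visited g k.2)).
Proof.
by case: k => b i; rewrite /visited /pmopp !xpair_eqE eqxx !andbT /=; case: b; case: eps.
Qed.

(** [g] exchanges visited and unvisited elements, since the visited elements are
    stable under v |-> - g(v), which permutes them. *)
Lemma visited_pairing k : (g k == visited g (g k).2) = (k != visited g k.2).
Proof.
apply/idP/idP => [/eqP e|].
  apply/eqP => e'; have := pairing_visited g_pairing k.2.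
  rewrite -e' e => /eqP; rewrite eq_sym; apply/negP; exact: pmopp_neq.
rewrite not_visited => /eqP e; have [i si] := cycle_succ_surj k.2.
have := pairing_visited g_pairing i; rewrite -/(succ i) si -e => <-.
by rewrite pairing_invol.
Qed.

Lemma prod_visited (R : comPzRingType) (H : pmidx n -> R) :
  \prod_k H k = \prod_i (H (visited g i) * H (g (visited g i))).
Proof.
transitivity (\prod_i (H (visited g i) * H (pmopp (visited g i)))).
  rewrite prod_signed; apply: eq_bigr => i _; rewrite /visited /pmopp /=.
  by case: eps => //=; rewrite mulrC.
rewrite !big_split /=; congr (_ * _).
rewrite (reindex_inj cycle_succ_inj) /=; apply: eq_bigr => i _.
by rewrite -pairing_visited.
Qed.

(** A function that is constant on the pairs of [g] is a function of the pairs.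
    Here [idx] numbers the pairs by 'I_n and [u] chooses one end of each pair;
    the numbering can be adapted to the sum to be computed. *)
Lemma sum_pairing_invariant (R : comPzRingType) (J : finType)
    (u : 'I_n -> pmidx n) (idx : pmidx n -> 'I_n)
    (G : {ffun pmidx n -> J} -> R) :
  cancel u idx -> (forall k, idx (g k) = idx k) ->
  (forall k, k = u (idx k) \/ k = g (u (idx k))) ->
  \sum_(c : {ffun pmidx n -> J} | [forall k, c (g k) == c k]) G c =
  \sum_(e : {ffun 'I_n -> J}) G [ffun k => e (idx k)].
Proof.
move=> uK idxg uidx.
rewrite (reindex_onto (fun e : {ffun 'I_n -> J} => [ffun k => e (idx k)])
   (fun c : {ffun pmidx n -> J} => [ffun i => c (u i)])) /=.
  apply: eq_bigl => e; apply/andP; split.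
    by apply/forallP => k; rewrite !ffunE idxg.
  by apply/eqP/ffunP => i; rewrite !ffunE uK.
move=> c /forallP h; apply/ffunP => k; rewrite !ffunE.
by case: (uidx k) => {2}-> //; rewrite (eqP (h _)).
Qed.

End PairingSums.

(** * Monomials as index sums *)

Section MonomialSums.
Variables (R : comPzRingType) (n m : nat) (C : finType).
Variables (g : {ffun pmidx n -> pmidx n}) (t : 'I_n -> C) (x : C -> 'M[R]_m).
Hypothesis g_pairing : g \in pairings n.

Lemma monomial_pE : monomial_p g t x =
  \sum_(a : {ffun 'I_n -> 'I_m}) \prod_i x (t i) (a i) (a (cycle_succ g i)).
Proof.
apply: prod_tr_cycles; first exact: flatten_cycles.
by move=> c; apply: fcycle_cycles.
Qed.

Lemma monomial_q_sum : monomial_q g t x =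
  \sum_(a : {ffun 'I_n -> 'I_m})
    \prod_i (if eps g i then (x (t i))^T else x (t i)) (a i) (a (cycle_succ g i)).
Proof.
apply: (@prod_tr_cycles _ _ _ _ (fun i => if eps g i then (x (t i))^T else x (t i))).
  exact: flatten_cycles.
by move=> c; apply: fcycle_cycles.
Qed.

(** A pair is numbered by the absolute value of its unvisited end.  With this
    choice the entry of [x] at [i] has as its indices the values of [a] at [i] and
    at its successor, in this order if -i is visited and in the opposite order,
    whence the transpose, if +i is visited. *)
Lemma monomial_qE : monomial_q g t x =
  \sum_(b : {ffun pmidx n -> 'I_m} | [forall k, b (g k) == b k])
     \prod_i x (t i) (b (true, i)) (b (false, i)).
Proof.
pose idx k := if k == visited g k.2 then (g k).2 else k.2.
rewrite (@sum_pairing_invariant _ g _ _ (fun i => pmopp (visited g i)) idx).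
- rewrite monomial_q_sum; apply: eq_bigr => a _; apply: eq_bigr => i _.
  rewrite !ffunE /idx /cycle_succ /visited /= !xpair_eqE eqxx !andbT.
  case: (eps g i) => /=; last by [].
  by rewrite mxE.
- move=> i; rewrite /idx [(pmopp _).2]/=.
  by rewrite (negbTE (pmopp_neq _)).
- move=> k; rewrite /idx visited_pairing //; case: eqP => //= _.
  by rewrite pairing_invol.
- move=> k; rewrite /idx; case: eqVneq => [e|].
    right; rewrite {2}e -pairing_visited // -e.
    by rewrite pairing_invol.
  by rewrite not_visited => /eqP; left.
Qed.

End MonomialSums.

(** * The Brauer product *)

Section BrauerProduct.
Variables (n : nat) (sigma gamma : {ffun pmidx n -> pmidx n}).
Hypothesis sigma_plus : sigma \in pairings_plus n.
Hypothesis gamma_pairing : gamma \in pairings n.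

Lemma pairings_plus_pairing : sigma \in pairings n.
Proof. by move: sigma_plus; rewrite inE => /andP[]. Qed.

Lemma pairings_plus_sign k : (sigma k).1 = ~~ k.1.
Proof.
move: sigma_plus; rewrite inE => /andP[_ /forallP/(_ k)].
by case: (sigma k).1; case: k.1.
Qed.

(** Expanding the entry of W at (a_i, a_(pi(sigma) i)) produces two Gaussian
    variables, numbered +i and -i, attached to its row and to its column.
    Variable [k] thus carries the index a_j, where j is the absolute value of
    [relabel k]; the sign keeps the relabelling bijective. *)
Definition relabel (k : pmidx n) : pmidx n :=
  if k.1 then k else sigma (pmopp k).
Definition unlabel (k : pmidx n) : pmidx n :=
  if k.1 then k else pmopp (sigma k).

Lemma relabelK : cancel relabel unlabel.
Proof.
move=> [[] i] //; rewrite /relabel /= /unlabel pairings_plus_sign /=.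
by rewrite (pairing_invol pairings_plus_pairing).
Qed.

Lemma unlabelK : cancel unlabel relabel.
Proof.
move=> [[] i] //; rewrite /unlabel /= /relabel /= pairings_plus_sign /= pmoppK.
by rewrite (pairing_invol pairings_plus_pairing).
Qed.

(** The pairs of the Brauer product are the relabelled pairs of [gamma]. *)
Lemma brauerE k : brauer sigma gamma k = relabel (gamma (unlabel k)).
Proof. by rewrite ffunE /relabel /unlabel; case: k => [[] i]. Qed.

Lemma brauer_pairing : brauer sigma gamma \in pairings n.
Proof.
rewrite inE; apply/forallP => k; rewrite !brauerE relabelK.
rewrite (pairing_invol gamma_pairing) unlabelK eqxx /=.
by rewrite (can2_eq relabelK unlabelK) pairing_neq.
Qed.

(** Every step changes the sign twice, so only positive elements are visited. *)
Lemma cycle_succ_plus i : cycle_succ sigma i = (relabel (false, i)).2.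
Proof.
rewrite /cycle_succ /relabel /= /pmopp /=; congr (sigma (_, _)).2.
have := visited_traversal pairings_plus_pairing i.
have [H _] := traversalP pairings_plus_pairing.
move=> /flattenP[c /(trav_orbit H)[j ->]].
rewrite -fconnect_orbit => /iter_findex /(congr1 fst) /= <-.
elim: (findex _ _ _) => //= k IH.
by rewrite pairings_plus_sign negbK.
Qed.

(** The inherited color is the color of the visited element, read before the
    relabelling. *)
Lemma brauer_coloringE (C : finType) (t : 'I_n -> C) i :
  brauer_coloring sigma gamma t i = t (unlabel (visited (brauer sigma gamma) i)).2.
Proof. by rewrite /brauer_coloring /visited /unlabel /=; case: eps. Qed.

(** The entry at [i] of (A' A) is a sum over an index attached to a pair of
    [gamma], namely the pair whose relabelled visited end is [visited i]; since
    [gamma] respects the coloring, both ends of the pair have the color of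
    that entry. *)
Lemma monomial_p_brauer (R : comPzRingType) (C : finType) (N : nat) (t : 'I_n -> C)
    (A : C -> 'M[R]_N) : gamma \in colored_pairings t ->
  monomial_p (brauer sigma gamma) (brauer_coloring sigma gamma t)
    (fun l => (A l)^T *m A l) =
  \sum_(a : {ffun 'I_n -> 'I_N})
    \sum_(c : {ffun pmidx n -> 'I_N} | [forall k, c (gamma k) == c k])
      \prod_k A (t k.2) (c k) (a (relabel k).2).
Proof.
rewrite inE => /andP[_ /forallP gt].
have bp := brauer_pairing; set h := brauer sigma gamma in bp *.
pose idx k := let k' := relabel k in
  if k' == visited h k'.2 then k'.2 else (h k').2.
have hE k : h (relabel k) = relabel (gamma k) by rewrite brauerE relabelK.
rewrite monomial_pE //; apply: eq_bigr => a _.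
rewrite (@sum_pairing_invariant _ gamma _ _ (fun i => unlabel (visited h i)) idx).
- transitivity (\prod_i \sum_x (A (brauer_coloring sigma gamma t i) x (a i) *
     A (brauer_coloring sigma gamma t i) x (a (cycle_succ h i)))).
    by apply: eq_bigr => i _; rewrite mxE; apply: eq_bigr => x _; rewrite mxE.
  rewrite bigA_distr_bigA /=; apply: eq_bigr => e _.
  rewrite [RHS](reindex unlabel) /=; last first.
    by exists relabel => k _; [exact: unlabelK|exact: relabelK].
  rewrite (prod_visited bp); apply: eq_bigr => i _.
  have eE k : [ffun k => e (idx k)] k = e (idx k) by rewrite ffunE.
  rewrite !eE !unlabelK /idx /= !unlabelK eqxx visited_pairing // eqxx /=.
  rewrite (pairing_invol bp) brauer_coloringE -/h.
  congr (_ * A _ _ _); rewrite brauerE relabelK.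
  by rewrite (eqP (gt _)).
- by move=> i; rewrite /idx unlabelK eqxx.
- move=> k; rewrite /idx /= -hE visited_pairing // (pairing_invol bp).
  by case: eqP.
- move=> k; rewrite /idx /=; case: eqVneq => [e|].
    by left; rewrite -e relabelK.
  rewrite -visited_pairing // => /eqP e; right.
  rewrite -e hE relabelK.
  by rewrite (pairing_invol gamma_pairing).
Qed.

End BrauerProduct.

(** * Integration against a weight *)

Section WeightedPushforward.
Local Open Scope ereal_scope.
Context d1 d2 (X : measurableType d1) (U : measurableType d2) (R : realType).
Variables (mu : {measure set X -> \bar R}) (nu : {measure set U -> \bar R}).
Variables (phi : X -> U) (Z : X -> R).
Hypotheses (mphi : measurable_fun setT phi) (mZ : measurable_fun setT Z).
Hypothesis Z0 : forall x, (0 <= Z x)%R.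

Hypothesis nuE : forall A, measurable A -> nu A = \int[mu]_(x in phi @^-1` A) (Z x)%:E.

Import HBNNSimple.

(** Both sides are continuous along increasing sequences of simple functions,
    and for indicators the identity is the hypothesis on [nu].  It is used for a
    law that has a density ([phi] the identity, [Z] the density) and for
    independence ([phi] a random variable, [Z] the product of the others). *)
Lemma ge0_integral_weighted (f : U -> \bar R) :
  measurable_fun setT f -> (forall y, 0 <= f y) ->
  \int[nu]_y f y = \int[mu]_x (f (phi x) * (Z x)%:E).
Proof.
move=> mf f0; pose f_ := nnsfun_approx measurableT mf.
have mZE : measurable_fun setT (EFin \o Z) by exact/measurable_EFinP.
have cvg_f y : limn (fun n => (f_ n y)%:E) = f y.
  by apply/cvg_lim => //; apply: cvg_nnsfun_approx.
transitivity (limn (fun n => \int[nu]_x (f_ n x)%:E)).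
  rewrite -monotone_convergence//.
  - by apply: eq_integral => y _; rewrite cvg_f.
  - by move=> n; exact/measurable_EFinP/measurable_funP.
  - by move=> n y _; rewrite lee_fin.
  - by move=> y _ m n mn; rewrite lee_fin; exact/lefP/nd_nnsfun_approx.
have mfphi n : measurable_fun setT (fun x => (f_ n (phi x))%:E).
  by apply/measurable_EFinP; apply: measurableT_comp => //; exact/measurable_funP.
transitivity (limn (fun n => \int[mu]_x ((f_ n (phi x))%:E * (Z x)%:E))); last first.
  rewrite -monotone_convergence//.
  - apply: eq_integral => x _; apply/cvg_lim => //; apply: cvgeZr => //.
    exact: cvg_nnsfun_approx.
  - by move=> n; apply: emeasurable_funM.
  - by move=> n x _; rewrite mule_ge0 // lee_fin.
  - move=> x _ m n mn; apply: lee_wpmul2r; rewrite lee_fin //.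
    exact/lefP/nd_nnsfun_approx.
congr (limn _); apply/funext => n.
have mpre k : measurable (phi @^-1` (f_ n @^-1` [set k])).
  by rewrite -[X in measurable X]setTI; apply: mphi.
transitivity (\sum_(k \in range (f_ n)) k%:E * nu (f_ n @^-1` [set k])).
  by rewrite integralT_nnsfun sintegralE.
transitivity (\sum_(k \in range (f_ n))
    \int[mu]_x ((k * \1_(f_ n @^-1` [set k]) (phi x))%:E * (Z x)%:E)); last first.
  rewrite -ge0_integral_fsum //.
  - apply: eq_integral => x _; rewrite fimfunE.
    rewrite -fsumEFin // ge0_mule_fsuml //.
    by move=> k; rewrite nnfun_muleindic_ge0.
  - move=> k; apply: emeasurable_funM => //; apply/measurable_EFinP.
    apply: measurable_funM => //.
    exact: (@measurable_indic _ _ _ setT _ (mpre k)).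
  - move=> k x _; apply: mule_ge0; last by rewrite lee_fin.
    by rewrite EFinM nnfun_muleindic_ge0.
apply: eq_fsbigr => k; rewrite inE => -[y _ <-].
have k0 : (0 <= f_ n y)%R by [].
under [RHS]eq_integral do rewrite EFinM -muleA.
rewrite ge0_integralZl_EFin //; last 2 first.
- by move=> x _; apply: mule_ge0; rewrite lee_fin.
- apply: emeasurable_funM => //; apply/measurable_EFinP.
  exact: (@measurable_indic _ _ _ setT _ (mpre (f_ n y))).
rewrite nuE // (integral_mkcond (phi @^-1` _)); congr (_ * _).
apply: eq_integral => x _; rewrite patchE indicE.
case: ifPn => [/set_mem/= h|/negP h]; first by rewrite mem_set ?mul1e.
by rewrite memNset ?mul0e // => /mem_set.
Qed.

End WeightedPushforward.

(** * Functions with moments of all orders *)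

Section Moments.
Context d (T : measurableType d) (R : realType) (P : probability T R).
Implicit Types f g : T -> R.

(** Square-integrability would not be stable under products; having moments of
    all orders is, and so these functions form an algebra on which expectation is
    linear without further side conditions. *)
Definition has_moments f : Prop :=
  measurable_fun setT f /\
  forall k : nat, P.-integrable setT (fun w => (`|f w| ^+ k)%:E).

Lemma has_moments_integrable f : has_moments f -> P.-integrable setT (EFin \o f).
Proof.
move=> [mf /(_ 1%N) intf]; apply: le_integrable intf => //.
  exact/measurable_EFinP.
by move=> w _ /=; rewrite expr1 normr_id.
Qed.

Let measurable_absX f k : measurable_fun setT f ->
  measurable_fun setT (fun w => (`|f w| ^+ k)%:E).
Proof.
move=> mf; apply/measurable_EFinP; apply: measurable_funX.
exact: measurableT_comp.
Qed.

(** Bounding the powers instead of the function itself is what sums and products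
    require. *)
Lemma has_moments_le f (g : nat -> T -> R) : measurable_fun setT f ->
  (forall k, P.-integrable setT (EFin \o g k)) ->
  (forall k w, `|f w| ^+ k <= g k w) -> has_moments f.
Proof.
move=> mf ig fg; split=> // k; apply: le_integrable (ig k) => //.
  exact: measurable_absX.
move=> w _ /=; rewrite lee_fin normrX normr_id.
exact: le_trans (fg k w) (ler_norm _).
Qed.

Lemma has_moments_cst c : has_moments (fun=> c).
Proof.
apply: (@has_moments_le _ (fun k _ => `|c| ^+ k)) => // k.
exact: finite_measure_integrable_cst.
Qed.

Lemma has_moments_indic (A : set T) : measurable A -> has_moments (\1_A).
Proof.
move=> mA; apply: (@has_moments_le _ (fun k _ => 1)).
- exact: measurable_indic.
- by move=> k; exact: finite_measure_integrable_cst.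
by move=> k w; rewrite indicE; case: (_ \in _);
  rewrite ?normr1 ?normr0 ?expr1n // expr0n lern1 leq_b1.
Qed.

Lemma has_momentsD f g : has_moments f -> has_moments g ->
  has_moments (fun w => f w + g w).
Proof.
move=> [mf If] [mg Ig].
apply: (@has_moments_le _ (fun k w => 2 ^+ k * (`|f w| ^+ k + `|g w| ^+ k))).
- exact: measurable_funD.
- move=> k; rewrite (_ : EFin \o _ = fun w =>
    ((2 ^+ k)%:E * ((`|f w| ^+ k)%:E + (`|g w| ^+ k)%:E))%E) //.
  by apply: integrableZl => //; apply: integrableD.
move=> k w; pose m := Num.max `|f w| `|g w|.
have fm : `|f w| <= m by rewrite le_max lexx.
have gm : `|g w| <= m by rewrite le_max lexx orbT.
apply: (@le_trans _ _ ((2 * m) ^+ k)).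
  rewrite lerXn2r ?nnegrE ?mulr_ge0 ?le_max ?normr_ge0 //.
  by rewrite (le_trans (ler_normD _ _)) // mulr_natl mulr2n lerD.
rewrite exprMn ler_pM2l ?exprn_gt0 //.
by rewrite /m; case: (leP `|f w| `|g w|) => _; rewrite ?lerDl ?lerDr exprn_ge0.
Qed.

Lemma has_momentsM f g : has_moments f -> has_moments g ->
  has_moments (fun w => f w * g w).
Proof.
move=> [mf If] [mg Ig].
apply: (@has_moments_le _ (fun k w => `|f w| ^+ (2 * k) + `|g w| ^+ (2 * k))).
- exact: measurable_funM.
- by move=> k; apply: (integrableD _ (If (2 * k)%N) (Ig (2 * k)%N)).
move=> k w; rewrite normrM exprMn !(mulnC 2) !exprM.
have a0 : 0 <= `|f w| ^+ k by rewrite exprn_ge0.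
have b0 : 0 <= `|g w| ^+ k by rewrite exprn_ge0.
have := sqr_ge0 (`|f w| ^+ k - `|g w| ^+ k); nra.
Qed.

Lemma has_moments_sum (I : Type) (r : seq I) (Q : pred I) (f : I -> T -> R) :
  (forall i, Q i -> has_moments (f i)) ->
  has_moments (fun w => \sum_(i <- r | Q i) f i w).
Proof.
move=> If; elim: r => [|i r IH].
  by under eq_fun do rewrite big_nil; exact: has_moments_cst.
have [Qi|/negbTE nQi] := boolP (Q i); last by under eq_fun do rewrite big_cons nQi.
by under eq_fun do rewrite big_cons Qi; apply: has_momentsD => //; apply: If.
Qed.

Lemma has_moments_prod (I : Type) (r : seq I) (Q : pred I) (f : I -> T -> R) :
  (forall i, Q i -> has_moments (f i)) ->
  has_moments (fun w => \prod_(i <- r | Q i) f i w).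
Proof.
move=> If; elim: r => [|i r IH].
  by under eq_fun do rewrite big_nil; exact: has_moments_cst.
have [Qi|/negbTE nQi] := boolP (Q i); last by under eq_fun do rewrite big_cons nQi.
by under eq_fun do rewrite big_cons Qi; apply: has_momentsM => //; apply: If.
Qed.

Lemma has_moments_funpos f : has_moments f -> has_moments (fun w => Num.max (f w) 0).
Proof.
move=> [mf If]; apply: (@has_moments_le _ (fun k w => `|f w| ^+ k)) => //.
  exact: measurable_maxr.
move=> k w; rewrite lerXn2r ?nnegrE //.
by case: (leP (f w) 0) => // _; rewrite normr0.
Qed.

Lemma Rintegral_sum_moments (I : Type) (r : seq I) (Q : pred I) (f : I -> T -> R) :
  (forall i, Q i -> has_moments (f i)) ->
  \int[P]_w (\sum_(i <- r | Q i) f i w) = \sum_(i <- r | Q i) \int[P]_w f i w.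
Proof.
move=> If; elim: r => [|i r IH].
  rewrite big_nil; under eq_Rintegral do rewrite big_nil.
  by rewrite Rintegral_cst // mul0r.
rewrite big_cons; have [Qi|/negbTE nQi] := boolP (Q i); last first.
  by under eq_Rintegral do rewrite big_cons nQi.
under eq_Rintegral do rewrite big_cons Qi.
rewrite RintegralD ?IH //.
- by apply: has_moments_integrable; apply: If.
- by apply: has_moments_integrable; apply: has_moments_sum.
Qed.

End Moments.

(** * Expectation of products of independent variables *)

Section Independence.
Context d (T : measurableType d) (R : realType) (P : probability T R).
Variables (I : finType) (F : I -> set_system T).
Hypothesis mF : forall i E, F i E -> measurable E.
Hypothesis indepF : mutually_independent P F.

Definition adapted (G : set_system T) (Y : T -> R) :=
  forall A : set R, measurable A -> G (Y @^-1` A).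

(** Independence is the case where all the factors are indicators.  They are
    replaced by nonnegative variables one at a time: by the induction hypothesis,
    the law of [Y i] weighted by the product [Z] of the other factors is [c] times
    the law of [Y i]. *)
Let expect_prod_indic (Y : I -> T -> R) (D : {set I}) (E : I -> set T) :
  (forall i, has_moments P (Y i)) -> (forall i, adapted (F i) (Y i)) ->
  (forall i w, 0 <= Y i w) -> (forall i, F i (E i)) ->
  (\int[P]_w (\prod_i (if i \in D then Y i w else \1_(E i) w))%:E =
   (\prod_i (if i \in D then \int[P]_w Y i w else fine (P (E i))))%:E)%E.
Proof.
move=> Ym YF Y0; have [m] := ubnP #|D|; elim: m D E => // m IH D E.
rewrite ltnS => Dm EF.
have [->|/finset.set0Pn [i iD]] := eqVneq D finset.set0.
  have mE : measurable (\bigcap_(i in [set` [set: I]%SET]) E i).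
    apply: fin_bigcap_measurable => [|i _]; last exact: mF (EF i).
    exact: finite_finset.
  transitivity (P (\bigcap_(i in [set` [set: I]%SET]) E i)).
    rewrite -[X in P X]setIT -integral_indic //; apply: eq_integral => w _.
    congr EFin; rewrite indicE; case: (boolP (_ \in _)) => [/set_mem h|/negP h].
      rewrite big1 // => i _; rewrite inE indicE mem_set //.
      by apply: h => /=; rewrite inE.
    have [i nE] : exists i, w \notin E i.
      apply/not_existsP => H; apply: h; apply/mem_set => i _.
      by apply: set_mem; apply: contrapT => /negP/H.
    by rewrite (bigD1 i) //= inE indicE (negbTE nE) mul0r.
  rewrite indepF // (big_morph EFin EFinM (erefl _)).
  apply: eq_big => [i|i _]; first by rewrite finset.in_setT.
  by rewrite finset.in_set0 fineK // fin_num_measure //; exact: mF (EF i).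
set c := \prod_(k | k != i) (if k \in D then \int[P]_w Y k w else fine (P (E k))).
have c0 : 0 <= c.
  by apply: prodr_ge0 => k _; case: ifP => _; [exact: Rintegral_ge0|exact: fine_ge0].
pose Z w := \prod_(k | k != i) (if k \in D then Y k w else \1_(E k) w).
have Yi0 := Y0 i.
have mYi : measurable_fun setT (Y i) by have [] := Ym i.
pose Ymix := isMeasurableFun.Build _ _ _ _ (Y i) mYi.
pose Yi : {mfun T >-> R} := HB.pack (Y i) Ymix.
have mZ : measurable_fun setT Z.
  have [] // : has_moments P Z; apply: has_moments_prod => k _.
  by case: (k \in D) => //; apply: has_moments_indic; exact: mF (EF k).
have Z0 w : 0 <= Z w.
  by apply: prodr_ge0 => k _; case: ifP => _; rewrite ?Y0 // indicE.
have iZ A : measurable A ->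
  (mscale (NngNum c0) (distribution P Yi) A = \int[P]_(w in Yi @^-1` A) (Z w)%:E)%E.
  move=> mA; pose E' k := if k == i then Y i @^-1` A else E k.
  have E'F k : F k (E' k).
    by rewrite /E'; case: eqVneq => [->|_]; [exact: YF|exact: EF].
  have Di : (#|D :\ i| < m)%N by move: Dm; rewrite (cardsD1 i D) iD.
  rewrite /mscale /= /distribution /pushforward integral_mkcond.
  transitivity (\int[P]_w (\prod_k (if k \in D :\ i then Y k w else \1_(E' k) w))%:E)%E.
    rewrite (IH (D :\ i) E' Di E'F) (bigD1 i) //= !inE eqxx /= {1}/E' eqxx.
    rewrite EFinM fineK ?fin_num_measure //; last exact: mF (YF _ _ mA).
    rewrite muleC; congr (_ * _%:E)%E.
    by apply: eq_bigr => k ki; rewrite !inE ki /= /E' (negbTE ki).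
  apply: eq_integral => w _; rewrite patchE (bigD1 i) //= !inE eqxx /= /E' eqxx indicE.
  rewrite (_ : \prod_(k | _) _ = Z w); last first.
    by apply: eq_bigr => k ki; rewrite !inE ki /= (negbTE ki).
  by case: ifP => _; rewrite ?mul1r ?mul0r.
have mabs : measurable_fun setT (fun y : R => `|y|%:E).
  by apply/measurable_EFinP; exact: normr_measurable.
have := ge0_integral_weighted mYi mZ Z0 iZ mabs (fun y => normr_ge0 y).
rewrite ge0_integral_mscale // ge0_integral_distribution //= => H.
rewrite (bigD1 i) //= iD.
transitivity (\int[P]_w (`|Y i w|%:E * (Z w)%:E))%E.
  by apply: eq_integral => w _; rewrite (bigD1 i) //= iD ger0_norm.
rewrite -H EFinM muleC /Rintegral fineK; last first.
  by apply: integrable_fin_num => //; exact: has_moments_integrable.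
by congr (_ * _)%E; apply: eq_integral => w _; rewrite /= ger0_norm.
Qed.

(** Both sides are additive in each factor, so the signed factors are replaced one
    at a time by their positive and negative parts. *)
Lemma Rintegral_prod_indep (Y : I -> T -> R) :
  (forall i, has_moments P (Y i)) -> (forall i, adapted (F i) (Y i)) ->
  \int[P]_w (\prod_i Y i w) = \prod_i \int[P]_w Y i w.
Proof.
suff H (D : {set I}) Y' : (forall i, has_moments P (Y' i)) ->
    (forall i, adapted (F i) (Y' i)) -> (forall i w, i \notin D -> 0 <= Y' i w) ->
    \int[P]_w (\prod_i Y' i w) = \prod_i \int[P]_w Y' i w.
  by move=> h1 h2; apply: (H [set: I]%SET) => // i w; rewrite inE.
have [m] := ubnP #|D|; elim: m D Y' => // m IH D {}Y.
rewrite ltnS => Dm Ym YF Y0.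
have [D0|/finset.set0Pn [i iD]] := eqVneq D finset.set0.
  have Y0' i w : 0 <= Y i w by apply: Y0; rewrite D0 inE.
  rewrite {1}/Rintegral.
  have := expect_prod_indic [set: I]%SET Ym YF Y0' (fun i => YF i setT measurableT).
  under [X in X = _ -> _]eq_integral do under eq_bigr do rewrite finset.in_setT.
  by move=> -> /=; apply: eq_bigr => i _; rewrite finset.in_setT.
pose Yi s k := if k == i then (fun w => Num.max (s * Y i w) 0) else Y k.
have Yim s k : has_moments P (Yi s k).
  rewrite /Yi; case: eqP => // _; apply: has_moments_funpos.
  by apply: has_momentsM => //; exact: has_moments_cst.
have YiF s k : adapted (F k) (Yi s k).
  rewrite /Yi; case: eqP => [->|_] // A mA.
  have -> : (fun w => Num.max (s * Y i w) 0) @^-1` A =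
     Y i @^-1` ((fun y => Num.max (s * y) 0) @^-1` A) by [].
  apply: YF; rewrite -[X in measurable X]setTI.
  suff : measurable_fun setT (fun y : R => Num.max (s * y) 0) by apply.
  by apply: measurable_maxr => //; apply: measurable_funM.
have Yi0 s k w : k \notin D :\ i -> 0 <= Yi s k w.
  rewrite !inE negb_and negbK /Yi; case: eqP => [_ _|_ /= kD]; last exact: Y0.
  by rewrite le_max lexx orbT.
have Di : (#|D :\ i| < m)%N by move: Dm; rewrite (cardsD1 i D) iD.
have IHs s := IH (D :\ i) (Yi s) Di (Yim s) (YiF s) (Yi0 s).
have YiE w : Y i w = Yi 1 i w - Yi (-1) i w.
  by rewrite /Yi eqxx mul1r mulN1r; case: leP => h1; case: leP => h2; lra.
have Yik s k : k != i -> Yi s k = Y k by rewrite /Yi => /negbTE ->.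
have YE w : \prod_k Y k w = \prod_k Yi 1 k w - \prod_k Yi (-1) k w.
  rewrite (bigD1 i) //= YiE mulrBl.
  rewrite [X in _ = X - _](bigD1 i) //= [X in _ = _ - X](bigD1 i) //=.
  by congr (_ * _ - _ * _); apply: eq_bigr => k /Yik ->.
under eq_Rintegral do rewrite YE.
rewrite RintegralB //; try by apply: has_moments_integrable; apply: has_moments_prod.
rewrite !IHs [X in X - _ = _](bigD1 i) //= [X in _ - X = _](bigD1 i) //=.
rewrite [RHS](bigD1 i) //=.
under [\int[P]_w Y i w]eq_Rintegral do rewrite YiE.
rewrite RintegralB ?mulrBl //; try exact: has_moments_integrable.
by congr (_ * _ - _ * _); apply: eq_bigr => k /Yik ->.
Qed.

End Independence.

(** * Moments of the standard normal law *)

Section StandardNormal.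
Variable R : realType.
Local Notation mu := (@lebesgue_measure R).
Local Notation phi := (@normal_pdf R 0 1).

Let phiE x : phi x = normal_peak 1 * expR (- x ^+ 2 / 2).
Proof. by rewrite normal_pdfE // /normal_fun subr0 expr1n. Qed.

Let phi_ge0 x : 0 <= phi x.
Proof. exact: normal_pdf_ge0. Qed.

(** exp(- x^2 / 2) is exp(- x^2 / 8), the shape of the density of standard
    deviation 2, times exp(- 3 x^2 / 8), which absorbs any power of |x|. *)
Lemma normrX_normal_pdf_le k :
  exists C : R, forall x, `|x| ^+ k * phi x <= C * normal_pdf 0 2 x.
Proof.
(* chosen so that 1 + x^2 <= K (1 + 3 x^2 / (8 (k+1))), to which 1 + y <= exp y
   is then applied before raising to the power k+1 *)
pose K : R := 1 + 8 / 3 * k.+1%:R.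
have K1 : 1 <= K by rewrite lerDl mulr_ge0.
exists (K ^+ k.+1 * (normal_peak 1 / normal_peak 2)) => x.
have p2 : 0 < normal_peak (2 : R) by exact: normal_peak_gt0.
rewrite phiE normal_pdfE // /normal_fun subr0.
set e1 := expR _; set e2 := expR _.
suff H : `|x| ^+ k * e1 <= K ^+ k.+1 * e2.
  rewrite (_ : _ * (_ * e2) = normal_peak 1 * (K ^+ k.+1 * e2)); last first.
    by field; rewrite gt_eqF.
  by rewrite mulrCA ler_wpM2l // normal_peak_ge0.
have -> : e1 = expR (- (3 / 8 * x ^+ 2)) * e2.
  by rewrite -expRD; congr expR; field.
rewrite mulrA ler_pM2r ?expR_gt0 // expRN ler_pdivrMr ?expR_gt0 //.
have x2 := sqr_ge0 x.
have y1 : 1 <= 1 + x ^+ 2 by rewrite lerDl.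
apply: (@le_trans _ _ ((1 + x ^+ 2) ^+ k.+1)).
  apply: (@le_trans _ _ ((1 + x ^+ 2) ^+ k)); last exact: ler_weXn2l.
  apply: lerXn2r; rewrite ?nnegrE //; first exact: le_trans y1.
  rewrite -(real_normK (num_real x)); have := normr_ge0 x; nra.
have -> : 3 / 8 * x ^+ 2 = (3 / 8 * x ^+ 2 / k.+1%:R) *+ k.+1.
  by rewrite -mulr_natr; field; rewrite addrC natr1.
rewrite -[_ *+ k.+1]mulr_natl expRM_natl -exprMn; apply: lerXn2r; rewrite ?nnegrE //.
- by rewrite (le_trans _ y1).
- by rewrite mulr_ge0 ?expR_ge0 // (le_trans _ K1).
apply: (@le_trans _ _ (K * (1 + 3 / 8 * x ^+ 2 / k.+1%:R))); last first.
  by apply: ler_wpM2l; [exact: le_trans K1|exact: expR_ge1Dx].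
have k0 : 0 < k.+1%:R :> R by [].
have h : 0 <= 3 / 8 * x ^+ 2 / k.+1%:R by apply: divr_ge0 => //; apply: mulr_ge0.
have a0 : 0 <= 8 / 3 * k.+1%:R :> R by apply: mulr_ge0.
have -> : K * (1 + 3 / 8 * x ^+ 2 / k.+1%:R) =
    1 + 3 / 8 * x ^+ 2 / k.+1%:R + 8 / 3 * k.+1%:R + x ^+ 2.
  by rewrite /K; field; rewrite addrC natr1.
by rewrite lerD2r -addrA lerDl addr_ge0.
Qed.

Lemma integrable_normal_moment k :
  mu.-integrable setT (fun x : R => (x ^+ k * phi x)%:E).
Proof.
have [C HC] := normrX_normal_pdf_le k.
have ig : mu.-integrable setT (fun x : R => (C%:E * (normal_pdf 0 2 x)%:E)%E).
  by apply: integrableZl => //; exact: integrable_normal_pdf.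
apply: le_integrable ig => //.
  apply/measurable_EFinP; apply: measurable_funM.
    exact: measurable_funX.
  exact: measurable_normal_pdf.
move=> x _ /=; rewrite lee_fin normrM normrX (ger0_norm (phi_ge0 x)).
exact: le_trans (HC x) (ler_norm _).
Qed.

Let is_derive_phi (x : R) : is_derive x 1 phi (- x * phi x).
Proof.
have -> : phi = fun x => normal_peak 1 * expR (- x ^+ 2 / 2).
  by apply/funext => y; rewrite phiE.
apply: is_derive_eq.
by rewrite /GRing.scale /=; field.
Qed.

Let is_derive_normal_moment j (x : R) :
  is_derive x 1 (fun x => x ^+ j * phi x)
    ((j%:R * x ^+ j.-1 - x ^+ j.+1) * phi x).
Proof.
have h := is_derive_phi x.
have -> : (fun x => x ^+ j * phi x) = (id ^+ j) * phi :> (R -> R).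
  by apply/funext => y; rewrite !fctE.
have hX := is_deriveX j (is_derive_id x (1 : R)).
have hM := is_deriveM hX h.
apply: is_derive_eq hM _; rewrite fctE /GRing.scale /= exprS; ring.
Qed.

Let continuous_normal_moment j : continuous (fun x : R => x ^+ j * phi x).
Proof.
move=> x; apply: differentiable_continuous; apply/derivable1_diffP.
by have [] := is_derive_normal_moment j x.
Qed.

Let normal_moment_tail j :
  (n.+1%:R ^+ j * phi n.+1%:R) @[n --> \oo] --> (0 : R).
Proof.
have [C HC] := normrX_normal_pdf_le j.+1.
have C0 : 0 <= C * normal_peak 2.
  apply: (@le_trans _ _ (C * normal_pdf 0 2 0)).
    by apply: le_trans (HC 0); rewrite mulr_ge0.
  by rewrite normal_pdfE // /normal_fun subrr expr0n /= oppr0 mul0r expR0 mulr1.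
apply: (@squeeze_cvgr _ _ _ _ (fun=> 0) (fun n => C * normal_peak 2 * n.+1%:R^-1)).
- apply: nearW => n; apply/andP; split; first by rewrite mulr_ge0.
  rewrite ler_pdivlMr // mulrAC -exprSr.
  have := HC n.+1%:R; rewrite ger0_norm // => /le_trans; apply.
  rewrite normal_pdfE // mulrA ler_piMr // /normal_fun -[leRHS]expR0 ler_expR.
  by rewrite subr0 mulNr oppr_le0 divr_ge0 // sqr_ge0.
- exact: cvg_cst.
- rewrite -[X in _ --> X](mulr0 (C * normal_peak 2)).
  apply: cvgMr; exact: cvg_harmonic.
Qed.

(** The integrand is the derivative of x^j phi(x), which vanishes at both
    infinities. *)
Lemma normal_moment_rec j :
  (\int[mu]_x ((j%:R * x ^+ j.-1 - x ^+ j.+1) * phi x)%:E = 0)%E.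
Proof.
pose h (x : R) := (j%:R * x ^+ j.-1 - x ^+ j.+1) * phi x.
have ih : mu.-integrable setT (EFin \o h).
  have -> : EFin \o h = (fun x : R => j%:R%:E * (x ^+ j.-1 * phi x)%:E -
       (x ^+ j.+1 * phi x)%:E)%E.
    by apply/funext => x /=; rewrite /h mulrBl -mulrA EFinB EFinM.
  apply: integrableB => //; last exact: integrable_normal_moment.
  by apply: integrableZl => //; exact: integrable_normal_moment.
pose A n : set R := `[- n.+1%:R, n.+1%:R]%classic.
have H1 : (\int[mu]_(x in A n) (h x)%:E @[n --> \oo] --> \int[mu]_x (h x)%:E)%E.
  under eq_fun do rewrite integral_mkcond.
  have iabs : mu.-integrable setT (fun x => `|(h x)%:E|%E) := integrable_abse ih.
  have := @dominated_cvg _ _ _ mu _ measurableT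
    (fun n => (fun x => (h x)%:E) \_ (A n)) (fun x => (h x)%:E)
    (fun x => `|(h x)%:E|%E).
  apply => //.
  - move=> n; apply/(measurable_restrictT _ _).1; first exact: measurable_itv.
    by apply: measurable_funTS; exact: measurable_int ih.
  - move=> x _; apply: cvg_near_cst.
    exists (Num.truncn `|x|) => // n /= xn.
    rewrite patchE mem_set // /A /= in_itv /= -ler_norml.
    rewrite (le_trans (ltW (truncnS_gt _))) // ler_nat //.
  - move=> n x _; rewrite patchE; case: ifP => // _.
    by rewrite abse0.
have H2 n : (\int[mu]_(x in A n) (h x)%:E =
   (n.+1%:R ^+ j * phi n.+1%:R - (- 1) ^+ j * (n.+1%:R ^+ j * phi n.+1%:R))%:E)%E.
  pose G (x : R) := x ^+ j * phi x.
  have cG : continuous G by exact: continuous_normal_moment.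
  rewrite (@continuous_FTC2 _ h G) //.
  - rewrite -EFinB; congr EFin; rewrite /G; congr (_ - _).
    by rewrite [(- n.+1%:R) ^+ j]exprNn -mulrA [phi (- _)]phiE sqrrN -phiE.
  - by apply: (@lt_trans _ _ 0); rewrite ?oppr_lt0.
  - apply: continuous_subspaceT => x.
    rewrite (_ : h = fun x => j%:R * (x ^+ j.-1 * phi x) - x ^+ j.+1 * phi x).
      apply: (@cvgB _ _ _ (nbhs x)); last exact: continuous_normal_moment.
      by apply: cvgMr; exact: continuous_normal_moment.
    by apply/funext => y; rewrite /h mulrBl -mulrA.
  - split.
    + by move=> x _; have [] := is_derive_normal_moment j x.
    + by apply: cvg_at_right_filter; exact: cG.
    + by apply: cvg_at_left_filter; exact: cG.
  - by move=> x _; rewrite derive1E; have [] := is_derive_normal_moment j x.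
move: H1; under eq_fun do rewrite H2.
move=> H1; apply: (cvg_unique _ H1) => //.
apply/fine_cvgP; split; first by near=> n.
rewrite (_ : fine \o _ = fun n => n.+1%:R ^+ j * phi n.+1%:R -
  (- 1) ^+ j * (n.+1%:R ^+ j * phi n.+1%:R)) //.
rewrite -[X in _ --> X](subrr 0) -[X in _ - X](mulr0 ((-1) ^+ j)).
apply: cvgB; first exact: normal_moment_tail.
by apply: cvgMr; exact: normal_moment_tail.
Unshelve. all: end_near.
Qed.

Lemma normal_moment_recE j :
  \int[mu]_x (x ^+ j.+1 * phi x) = j%:R * \int[mu]_x (x ^+ j.-1 * phi x).
Proof.
have i1 := integrable_normal_moment j.-1.
have i2 := integrable_normal_moment j.+1.
apply/esym/subr0_eq; rewrite -RintegralZl // -RintegralB //; last first.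
  by rewrite (_ : EFin \o _ = fun x : R => j%:R%:E * (x ^+ j.-1 * phi x)%:E)%E //;
     apply: integrableZl.
rewrite /Rintegral -[RHS]/(fine 0%E) -(normal_moment_rec j); congr fine.
by apply: eq_integral => x _; congr EFin; rewrite mulrBl mulrA.
Qed.

(** Two consecutive moments are computed together because the recursion goes from
    [k] to [k.+2]. *)
Lemma normal_momentE k :
  \int[mu]_x (x ^+ k * phi x) = (gauss_moment k)%:R.
Proof.
suff H : \int[mu]_x (x ^+ k * phi x) = (gauss_moment k)%:R /\
         \int[mu]_x (x ^+ k.+1 * phi x) = (gauss_moment k.+1)%:R by case: H.
elim: k => [|k [IH1 IH2]]; split => //.
- rewrite /Rintegral; under eq_integral do rewrite expr0 mul1r.
  by rewrite integral_normal_pdf.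
- by rewrite normal_moment_recE mul0r.
- by rewrite normal_moment_recE /= IH1 natrM.
Qed.

Section Transfer.
Context d (T : measurableType d) (P : probability T R) (X : {RV P >-> R}).
Hypothesis X_normal : forall A : set R, measurable A ->
  distribution P X A = normal_prob 0 1 A.

Lemma ge0_integral_normal_RV (f : R -> R) : measurable_fun setT f ->
  (forall y, 0 <= f y) ->
  (\int[P]_w (f (X w))%:E = \int[mu]_x (f x * phi x)%:E)%E.
Proof.
move=> mf f0; have mfE : measurable_fun setT (EFin \o f) by exact/measurable_EFinP.
rewrite -[LHS](@ge0_integral_distribution _ _ _ _ _ P X (EFin \o f)) //.
rewrite (@ge0_integral_weighted _ _ (measurableTypeR R) _ _ mu _ (@id R) phi) //.
- exact: measurable_normal_pdf.
Qed.

Lemma integrable_normal_RV (f : R -> R) : measurable_fun setT f ->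
  mu.-integrable setT (fun x => (f x * phi x)%:E) ->
  P.-integrable setT (fun w => (f (X w))%:E).
Proof.
move=> mf /integrableP[_ fin]; apply/integrableP; split.
  by apply/measurable_EFinP; apply: measurableT_comp.
rewrite (ge0_integral_normal_RV (f := fun y => `|f y|)) //; last first.
  exact: measurableT_comp.
rewrite (le_lt_trans _ fin) // le_eqVlt; apply/orP; left; apply/eqP.
by apply: eq_integral => x _; rewrite abse_EFin normrM (ger0_norm (phi_ge0 x)).
Qed.

(** Only the nonnegative case follows from the density directly; a signed
    function is the difference of its positive and negative parts. *)
Lemma Rintegral_normal_RV (f : R -> R) : measurable_fun setT f ->
  mu.-integrable setT (fun x => (f x * phi x)%:E) ->
  \int[P]_w f (X w) = \int[mu]_x (f x * phi x).
Proof.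
move=> mf intf.
pose p s x := Num.max (s * f x) 0.
have mp s : measurable_fun setT (p s).
  by apply: measurable_maxr => //; apply: measurable_funM.
have p0 s x : 0 <= p s x by rewrite /p le_max lexx orbT.
have fE x : f x = p 1 x - p (-1) x.
  by rewrite /p mul1r mulN1r; case: (leP (f x) 0) => h1; case: (leP (- f x) 0) => h2; lra.
have ip s : `|s| <= 1 -> mu.-integrable setT (fun x => (p s x * phi x)%:E).
  move=> s1; apply: le_integrable intf => //.
    apply/measurable_EFinP; apply: measurable_funM; first exact: mp.
    exact: measurable_normal_pdf.
  move=> x _; rewrite !abse_EFin lee_fin !normrM ler_wpM2r //.
  rewrite ger0_norm // /p ge_max normr_ge0 andbT (le_trans (ler_norm _)) //.
  by rewrite normrM ler_piMl.
have s1 : `|1 : R| <= 1 by rewrite normr1.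
have s2 : `|- 1 : R| <= 1 by rewrite normrN normr1.
under eq_Rintegral do rewrite fE.
have iX s : `|s| <= 1 -> P.-integrable setT (EFin \o (fun w => p s (X w))).
  by move=> hs; apply: integrable_normal_RV (mp s) (ip s hs).
rewrite RintegralB ?iX //.
under [RHS]eq_Rintegral do rewrite fE mulrBl.
rewrite RintegralB // /Rintegral ?ge0_integral_normal_RV //; exact: ip.
Qed.

Lemma has_moments_normal : has_moments P X.
Proof.
split=> // k; apply: (@integrable_normal_RV (fun x => `|x| ^+ k)).
  by apply: measurable_funX; exact: normr_measurable.
apply: le_integrable (integrable_normal_moment k) => //.
  apply/measurable_EFinP; apply: measurable_funM; last exact: measurable_normal_pdf.
  by apply: measurable_funX; exact: normr_measurable.
by move=> x _; rewrite !abse_EFin lee_fin !normrM !normrX normr_id.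
Qed.

Lemma expect_normal_moment k : \int[P]_w (X w ^+ k) = (gauss_moment k)%:R.
Proof.
rewrite -normal_momentE; apply: (@Rintegral_normal_RV (fun x => x ^+ k)).
  exact: measurable_funX.
exact: integrable_normal_moment.
Qed.

End Transfer.

End StandardNormal.

(** * Expectations of Gaussian and Wishart monomials *)

Section Expectations.
Context d (T : measurableType d) (R : realType) (P : probability T R).

(** Distributing the sums out of the expectations: a global choice [b] of terms is
    the same as a choice for each class of [t] separately.  On the class [l] a
    local choice is encoded by a function on all of [I] that takes the value [j0]
    outside the class. *)
Lemma Rintegral_prod_sum (I J L : finType) (t : I -> L) (i0 : I)
    (f : I -> J -> T -> R) : (forall i j, has_moments P (f i j)) ->
  \prod_l \int[P]_w \prod_(i | t i == l) \sum_j f i j w =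
  \sum_(b : {ffun I -> J}) \prod_l \int[P]_w \prod_(i | t i == l) f i (b i) w.
Proof.
move=> fm; have [j0 _|noJ] := pickP (xpredT : pred J); last first.
  rewrite [RHS]big1 => [|b _]; last by have := noJ (b i0).
  rewrite (bigD1 (t i0)) //= [X in X * _](_ : _ = 0) ?mul0r //.
  under eq_Rintegral => w _.
    rewrite (bigD1 i0) //= big1 => [|j _]; last by have := noJ j.
    rewrite mul0r; over.
  by rewrite Rintegral_cst // mul0r.
pose Q l := pfamily j0 (fun i => t i == l) (fun=> predT).
transitivity (\prod_l \sum_(b | b \in Q l)
    \int[P]_w \prod_(i | t i == l) f i (b i) w).
  apply: eq_bigr => l _.
  rewrite -Rintegral_sum_moments; last by move=> b _; apply: has_moments_prod.
  by apply: eq_Rintegral => w _; rewrite (big_distr_big_dep j0).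
rewrite bigA_distr_big_dep.
rewrite (reindex_onto
  (fun b : {ffun I -> J} => [ffun l => [ffun i => if t i == l then b i else j0]])
  (fun h : {ffun L -> {ffun I -> J}} => [ffun i => h (t i) i])) /=; last first.
  move=> h /familyP hQ; apply/ffunP => l; apply/ffunP => i; rewrite !ffunE.
  case: eqP => [<- //|/eqP tl]; have /pfamilyP[/supportP sup _] := hQ l.
  by rewrite sup.
apply: eq_big => [b|b _].
  apply/andP; split; last first.
    by apply/eqP/ffunP => i; rewrite !ffunE eqxx.
  apply/familyP => l; rewrite ffunE; apply/pfamilyP; split=> //.
  by apply/supportP => i; rewrite ffunE unfold_in => /negbTE ->.
apply: eq_bigr => l _; apply: eq_Rintegral => w _.
by apply: eq_bigr => i /eqP ti; rewrite !ffunE ti eqxx.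
Qed.

Lemma Rintegral_normal_monomial (M N : nat) (X : 'I_M -> 'I_N -> {RV P >-> R})
    (K : finType) (Q : pred K) (v : K -> 'I_M * 'I_N) :
  iid_standard_normal X ->
  \int[P]_w \prod_(k | Q k) X (v k).1 (v k).2 w =
  \prod_ij (gauss_moment #|[set k | Q k && (v k == ij)]%SET|)%:R.
Proof.
move=> [Xnormal Xindep].
pose Y (ij : 'I_M * 'I_N) w := X ij.1 ij.2 w ^+ #|[set k | Q k && (v k == ij)]%SET|.
have YE w : \prod_(k | Q k) X (v k).1 (v k).2 w = \prod_ij Y ij w.
  rewrite (partition_big v xpredT) //=; apply: eq_bigr => ij _.
  rewrite (eq_bigr (fun=> X ij.1 ij.2 w)) => [|k /andP[_ /eqP->] //].
  by rewrite prodr_const; congr (_ ^+ _); apply: eq_card => k; rewrite !inE.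
have Xm i j : has_moments P (X i j).
  by apply: has_moments_normal => A mA; exact: Xnormal.
under eq_Rintegral do rewrite YE.
rewrite (Rintegral_prod_indep _ Xindep).
- apply: eq_bigr => ij _; apply: expect_normal_moment => A mA; exact: Xnormal.
- move=> ij E [A mA <-]; exact: measurable_funP.
- move=> ij; have -> : Y ij = fun w =>
      \prod_(k in [set k | Q k && (v k == ij)]%SET) X ij.1 ij.2 w.
    by apply/funext => w; rewrite prodr_const.
  exact: has_moments_prod.
- move=> ij A mA; exists ((fun y => y ^+ #|[set k | Q k && (v k == ij)]%SET|) @^-1` A).
    by rewrite -[X in measurable X]setTI; apply: measurable_funX.
  by rewrite setTI.
Qed.

(** Measurability with respect to the sigma-algebra of [W] is measurability on [T]
    equipped with that sigma-algebra, where products of measurable functions are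
    available. *)
Lemma adapted_entries_prod (m n : nat) (W : T -> 'M[R]_(m, n)) (I : finType)
    (Q : pred I) (u : I -> 'I_m) (v : I -> 'I_n) :
  adapted (sigma_mx W) (fun w => \prod_(i | Q i) W w (u i) (v i)).
Proof.
rewrite /sigma_mx; set G := (G in <<s G >>).
have mW i j : measurable_fun setT (fun w : g_sigma_algebraType G => W w i j).
  move=> _ A mA; apply: sub_sigma_algebra; exists (i, j) => //=.
  by exists A.
have mY : measurable_fun setT
    (fun w : g_sigma_algebraType G => \prod_(i | Q i) W w (u i) (v i)).
  under eq_fun do rewrite big_mkcond.
  apply: measurable_prod => i _; case: (Q i) => //; exact: measurable_cst.
by move=> A mA; have := mY measurableT A mA; rewrite setTI.
Qed.

Lemma sigma_mx_measurable (m n : nat) (W : T -> 'M[R]_(m, n)) :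
  (forall i j, measurable_fun setT (fun w => W w i j)) ->
  forall E, sigma_mx W E -> measurable E.
Proof.
move=> mW E; apply: smallest_sub; first exact: sigma_algebra_measurable.
by move=> _ [ij _ [A mA <-]]; exact: mW.
Qed.

End Expectations.

Lemma congruence_entry (R : comPzRingType) (M N : nat) (A : 'M[R]_N)
    (B : 'M[R]_M) (X : 'M[R]_(M, N)) (a a' : 'I_N) :
  (A^T *m X^T *m B *m X *m A) a a' =
  \sum_(p : ('I_M * 'I_N) * ('I_M * 'I_N))
     A p.1.2 a * B p.1.1 p.2.1 * A p.2.2 a' * (X p.1.1 p.1.2 * X p.2.1 p.2.2).
Proof.
transitivity (\sum_b \sum_c \sum_b' \sum_c'
    A c a * B b b' * A c' a' * (X b c * X b' c')).
  rewrite -!mulmxA mulmxA mxE; apply: eq_bigr => b _.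
  rewrite mxE big_distrl; apply: eq_bigr => c _ /=.
  rewrite !mxE big_distrr; apply: eq_bigr => b' _ /=.
  rewrite !mxE !big_distrr; apply: eq_bigr => c' _ /=.
  by ring.
rewrite pair_bigA /= [RHS](eq_bigr (fun p => A p.1.2 a * B p.1.1 p.2.1 * A p.2.2 a' *
   (X p.1.1 p.1.2 * X p.2.1 p.2.2))) //.
rewrite -(pair_bigA _ (fun p q : 'I_M * 'I_N => A p.2 a * B p.1 q.1 * A q.2 a' *
   (X p.1 p.2 * X q.1 q.2))) /=.
by apply: eq_bigr => p _; rewrite pair_bigA.
Qed.

Section WishartMoments.
Context d (T : measurableType d) (R : realType) (P : probability T R).
Variables (M N n s : nat) (t : 'I_n -> 'I_s).
Variables (A : 'I_s -> 'M[R]_N) (B : 'I_s -> 'M[R]_M).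
Variable X : 'I_s -> 'I_M -> 'I_N -> {RV P >-> R}.
Hypothesis n_gt0 : (0 < n)%N.
Hypothesis X_iid : forall l, iid_standard_normal (X l).

Let W l w := (A l)^T *m (rmx (X l) w)^T *m B l *m rmx (X l) w *m A l.

Lemma has_moments_gaussian l i j : has_moments P (X l i j).
Proof. by apply: has_moments_normal => E mE; have [h _] := X_iid l; exact: h. Qed.

Lemma has_moments_wishart l a a' : has_moments P (fun w => W l w a a').
Proof.
under eq_fun do rewrite /W congruence_entry.
apply: has_moments_sum => p _; apply: has_momentsM; first exact: has_moments_cst.
by apply: has_momentsM; under eq_fun do rewrite mxE; apply: has_moments_gaussian.
Qed.

(** Wick's formula.  Each color contributes the moments of its own family; over all
    colors these are the moments at the labels (t |k|, b_k, c_k), and their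
    product counts the pairings that only pair equal labels. *)
Lemma gaussian_pairing_count (b : {ffun pmidx n -> 'I_M}) (c : {ffun pmidx n -> 'I_N}) :
  \prod_l \int[P]_w \prod_(i | t i == l)
     (X l (b (true, i)) (c (true, i)) w * X l (b (false, i)) (c (false, i)) w) =
  \sum_(g in colored_pairings t)
    ([forall k, b (g k) == b k] && [forall k, c (g k) == c k])%:R.
Proof.
transitivity ((\prod_(v : 'I_s * ('I_M * 'I_N))
    gauss_moment #|[set k | (t k.2, (b k, c k)) == v]%SET|)%:R : R).
  rewrite natr_prod (eq_bigr (fun v => (gauss_moment
    #|[set k | (t k.2, (b k, c k)) == (v.1, v.2)]%SET|)%:R)) => [|[] //].
  rewrite -(pair_bigA _ (fun l ij => (gauss_moment
    #|[set k | (t k.2, (b k, c k)) == (l, ij)]%SET|)%:R)) /=.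
  apply: eq_bigr => l _.
  have := @Rintegral_normal_monomial _ _ _ P _ _ (X l) (pmidx n)
    (fun k => t k.2 == l) (fun k => (b k, c k)) (X_iid l).
  rewrite /= => H; rewrite -[RHS]H; apply: eq_Rintegral => w _.
  rewrite [RHS]big_mkcond prod_signed big_mkcond; apply: eq_bigr => i _ /=.
  by case: ifP => // _; rewrite mulr1.
rewrite -card_invariant_pairings -sum1_card natr_sum.
rewrite [LHS]big_mkcond [RHS]big_mkcond; apply: eq_bigr => g _ /=.
rewrite !inE; case: [forall j, _] => //=.
have -> : [forall k, (t (g k).2, (b (g k), c (g k))) == (t k.2, (b k, c k))] =
  [&& [forall k, t (g k).2 == t k.2], [forall k, b (g k) == b k] &
      [forall k, c (g k) == c k]].
  apply/forallP/and3P => [h|[/forallP h1 /forallP h2 /forallP h3] k].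
    by split; apply/forallP => k; have /eqP[h1 h2 h3] := h k; apply/eqP.
  by rewrite (eqP (h1 k)) (eqP (h2 k)) (eqP (h3 k)).
by case: [forall k, t _ == _] => //=; case: (_ && _).
Qed.

(** The sums over [b] and [c] of Wick's formula separate: the entries of [B]
    involve only [b], and those of [A] only [c]. *)
Lemma wishart_product_moment (a a' : 'I_n -> 'I_N) :
  \prod_l \int[P]_w \prod_(i | t i == l) W l w (a i) (a' i) =
  \sum_(g in colored_pairings t) monomial_q g t B *
    \sum_(c : {ffun pmidx n -> 'I_N} | [forall k, c (g k) == c k])
      \prod_k A (t k.2) (c k) (if k.1 then a k.2 else a' k.2).
Proof.
pose K := pmidx n; pose J := (('I_M * 'I_N) * ('I_M * 'I_N))%type.
pose coef i (p : J) :=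
  A (t i) p.1.2 (a i) * B (t i) p.1.1 p.2.1 * A (t i) p.2.2 (a' i).
pose f i (p : J) w :=
  coef i p * (X (t i) p.1.1 p.1.2 w * X (t i) p.2.1 p.2.2 w).
have fm i p : has_moments P (f i p).
  apply: has_momentsM; first exact: has_moments_cst.
  by apply: has_momentsM; exact: has_moments_gaussian.
transitivity (\prod_l \int[P]_w \prod_(i | t i == l) \sum_p f i p w).
  apply: eq_bigr => l _; apply: eq_Rintegral => w _; apply: eq_bigr => i /eqP ti.
  rewrite /W congruence_entry; apply: eq_bigr => p _.
  by rewrite /f /coef !mxE ti.
rewrite (Rintegral_prod_sum _ (Ordinal n_gt0) fm).
pose ofbc (bc : {ffun K -> 'I_M} * {ffun K -> 'I_N}) : {ffun 'I_n -> J} :=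
  [ffun i =>
    ((bc.1 (true, i), bc.2 (true, i)), (bc.1 (false, i), bc.2 (false, i)))].
pose tobc (h : {ffun 'I_n -> J}) : {ffun K -> 'I_M} * {ffun K -> 'I_N} :=
  ([ffun k => (if k.1 then (h k.2).1 else (h k.2).2).1],
   [ffun k => (if k.1 then (h k.2).1 else (h k.2).2).2]).
rewrite (reindex ofbc) /=; last first.
  exists tobc => [[b c]|h] _; rewrite /tobc /ofbc /=.
    by congr (_, _); apply/ffunP => -[[] i]; rewrite !ffunE.
  by apply/ffunP => i; rewrite !ffunE /=; case: (h i) => [[? ?] [? ?]].
transitivity (\sum_(bc : {ffun K -> 'I_M} * {ffun K -> 'I_N})
   \sum_(g in colored_pairings t) (\prod_i coef i (ofbc bc i)) *
    ([forall k, bc.1 (g k) == bc.1 k] && [forall k, bc.2 (g k) == bc.2 k])%:R).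
  apply: eq_bigr => bc _; rewrite -big_distrr /= -gaussian_pairing_count.
  rewrite [X in _ = X * _](partition_big t xpredT) //= -big_split /=.
  apply: eq_bigr => l _; rewrite -RintegralZl //; last first.
    apply: has_moments_integrable; apply: has_moments_prod => i _.
    by apply: has_momentsM; exact: has_moments_gaussian.
  apply: eq_Rintegral => w _; rewrite -big_split /=; apply: eq_bigr => i /eqP ti.
  by rewrite /f !ffunE /= ti.
rewrite exchange_big /=; apply: eq_bigr => g gt.
rewrite monomial_qE; last by move: gt; rewrite inE => /andP[].
rewrite big_distrlr /= pair_big_dep /= [RHS]big_mkcond /=.
apply: eq_bigr => -[b c] _ /=.
case: (_ && _); last by rewrite mulr0.
rewrite mulr1 prod_signed -big_split /=; apply: eq_bigr => i _.
by rewrite /coef !ffunE /=; ring.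
Qed.

End WishartMoments.

Theorem theorem2p9 (R : realType) (d : measure_display) (T : measurableType d)
    (P : probability T R) (M N s : nat)
    (B : 'I_s -> 'M[R]_M) (Sigma : 'I_s -> 'M[R]_N)
    (W : 'I_s -> T -> 'M[R]_N)
    (Sigma_pd : forall l, posdefmx (Sigma l))
    (W_wishart : forall l, wishart P (Sigma l) (B l) (W l))
    (W_indep : mutually_independent P (fun l => sigma_mx (W l)))
    (n : nat) (n_ge1 : (1 <= n)%N) (t : 'I_n -> 'I_s)
    (sigma : {ffun pmidx n -> pmidx n}) (sigma_plus : sigma \in pairings_plus n) :
  'E_P[fun w => monomial_p sigma t (fun l => W l w)]%E =
  (\sum_(gamma in colored_pairings t)
     monomial_q gamma t B *
     monomial_p (brauer sigma gamma) (brauer_coloring sigma gamma t) Sigma)%:E.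
Proof.
have [A /choice[X WE]] := choice W_wishart.
have Xiid l : iid_standard_normal (X l) by case: (WE l).
have WAX l w : W l w = (A l)^T *m (rmx (X l) w)^T *m B l *m rmx (X l) w *m A l.
  by case: (WE l).
have SA : Sigma = (fun l => (A l)^T *m A l).
  by apply/funext => l; case: (WE l).
have Wm l a a' : has_moments P (fun w => W l w a a').
  by under eq_fun do rewrite WAX; exact: has_moments_wishart.
have sp := pairings_plus_pairing sigma_plus.
pose Y (a : {ffun 'I_n -> 'I_N}) l w :=
  \prod_(i | t i == l) W l w (a i) (a (cycle_succ sigma i)).
have YE w : monomial_p sigma t (fun l => W l w) = \sum_a \prod_l Y a l w.
  rewrite monomial_pE //; apply: eq_bigr => a _.
  rewrite (partition_big t xpredT) //=; apply: eq_bigr => l _.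
  by apply: eq_bigr => i /eqP ->.
have Ym a l : has_moments P (Y a l) by apply: has_moments_prod.
have Em : has_moments P (fun w => monomial_p sigma t (fun l => W l w)).
  under eq_fun do rewrite YE.
  by apply: has_moments_sum => a _; apply: has_moments_prod.
rewrite unlock -[LHS]fineK; last first.
  by apply: integrable_fin_num => //; exact: has_moments_integrable Em.
rewrite -/(Rintegral P setT (fun w => monomial_p sigma t (fun l => W l w))).
congr EFin; under eq_Rintegral do rewrite YE.
rewrite Rintegral_sum_moments; last by move=> a _; apply: has_moments_prod.
transitivity (\sum_(a : {ffun 'I_n -> 'I_N}) \sum_(g in colored_pairings t)
   monomial_q g t B *
    \sum_(c : {ffun pmidx n -> 'I_N} | [forall k, c (g k) == c k])
      \prod_k A (t k.2) (c k) (a (relabel sigma k).2)).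
  apply: eq_bigr => a _; rewrite (Rintegral_prod_indep _ W_indep) //; first last.
  - by move=> l; exact: adapted_entries_prod.
  - by move=> l E; apply: sigma_mx_measurable => i j; have [] := Wm l i j.
  rewrite /Y; under eq_bigr do under eq_Rintegral do under eq_bigr do rewrite WAX.
  rewrite (wishart_product_moment t A B n_ge1 Xiid); apply: eq_bigr => g _.
  congr (_ * _); apply: eq_bigr => c _; apply: eq_bigr => -[[] i] _ //=.
  by rewrite cycle_succ_plus.
rewrite exchange_big /=; apply: eq_bigr => g gt.
rewrite -big_distrr /=; congr (_ * _).
rewrite SA monomial_p_brauer //.
by move: gt; rewrite inE => /andP[].
Qed.
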